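(* Consider an irrotational deep-water Stokes wave with wavelength $\lambda$ and wave speed $c$. The streamline time-period $\mathcal{T}(p)$ of the fluid particle paths satisfies $$\frac{\lambda}{c}<\mathcal{T}(p)\le\int_{-\lambda/2}^{\lambda/2}\frac{1}{c-u(x,\eta(x))}\,dx\qquad\text{for every }0\le p<+\infty,$$ where $\lambda/c$ is the wave period. Moreover, no fluid particle has a closed path, and the drift along any streamline is positive: for every particle path $t\mapsto(x(t),y(t))$ lying on the streamline $p$ and every initial time $t_0$, with $\mathcal{T}=\mathcal{T}(p)$, $$x(\mathcal{T}+t_0)-x(t_0)=c\mathcal{T}-\lambda>0.$$
   Context: Setting (irrotational deep-water Stokes wave in the moving frame). Let $c>0$ (wave speed), $\lambda>0$ (wavelength), $g>0$ and $P_{atm}$ be constants. In the frame moving with the wave (horizontal coordinate $x$ stands for $x-ct$), the free surface is $y=\eta(x)$, the fluid domain is $D=\{(x,y)\in\mathbb{R}^2:-\infty<y<\eta(x)\}$, $(u(x,y),v(x,y))$ is the velocity field and $P(x,y)$ the pressure. They satisfy - $(u-c)u_x+vu_y=-P_x$, $(u-c)v_x+vv_y=-P_y-g$, $u_x+v_y=0$, $u_y-v_x=0$ in $D$; - $v=(u-c)\eta_x$ and $P=P_{atm}$ on $y=\eta(x)$; - $(u,v)\to(0,0)$ as $y\to-\infty$, uniformly in $x$; - $u(x,y)<c$ for all $-\infty<y\le\eta(x)$. The functions $\eta,u,v,P$ are $\lambda$-periodic in $x$; $\eta,u,P$ are symmetric (even) about the crest line $x=0$; $\eta$ is strictly increasing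 on $[-\lambda/2,0]$ and strictly decreasing on $[0,\lambda/2]$ (a single crest and trough per period; in particular the surface is not flat). The velocity field $(u,v)$ is bounded and continuously differentiable throughout the fluid domain, and continuous up to the free surface. Streamlines. The stream function $\psi$ is given by $\psi_y=u-c$, $\psi_x=-v$ in $D$, $\psi=0$ on $y=\eta(x)$; it takes all values in $(0,+\infty)$ on each vertical line in $D$. For $p\ge0$ the streamline $p$ is the curve $y=\xi_p(x)$ determined by $\psi(x,\xi_p(x))=p$; $p=0$ corresponds to the free surface, $\xi_0=\eta$. Particle paths. In the fixed frame, particle paths solve $x'(t)=u(x(t)-ct,y(t))$, $y'(t)=v(x(t)-ct,y(t))$ with $(x(t_0),y(t_0))=(x_0,y_0)$. The path lies on the streamline $p$ when $y_0=\xi_p(x_0-ct_0)$ (in the moving frame the particle then stays on that streamline). The streamline time-period $\mathcal{T}(p)$ is the unique $\mathcal{T}>0$ with $x(\mathcal{T}+t_0)-c\mathcal{T}=x_0-\lambda$; it depends only on $p$, not on $(x_0,t_0)$. A particle path is closed if the motion $t\mapsto(x(t),y(t))$ in the fixed frame is periodic in time. *)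

(* Defs.v *)
From Stdlib Require Import Reals.
From Coquelicot Require Import Coquelicot.
Open Scope R_scope.

Definition fluid_domain (eta : R -> R) (z : R * R) : Prop :=
  snd z < eta (fst z).

Definition closed_fluid (eta : R -> R) (z : R * R) : Prop :=
  snd z <= eta (fst z).

Definition uncurry (f : R -> R -> R) (z : R * R) : R := f (fst z) (snd z).

Definition partial_x (f : R -> R -> R) (x y : R) : R :=
  Derive (fun s => f s y) x.

Definition partial_y (f : R -> R -> R) (x y : R) : R :=
  Derive (fun s => f x s) y.

(** [Derive] is total, so existence of the partial derivatives is required
    separately from their continuity. *)
Record C1_on (D : R * R -> Prop) (f : R -> R -> R) : Prop := {
  C1_ex_x : forall x y, D (x, y) -> ex_derive (fun s => f s y) x;
  C1_ex_y : forall x y, D (x, y) -> ex_derive (fun s => f x s) y;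
  C1_cont_x : continuous_on D (uncurry (partial_x f));
  C1_cont_y : continuous_on D (uncurry (partial_y f))
}.

(** Irrotational deep-water Stokes wave in the frame moving with the wave.
    The functions [u v P] are total, but every condition only concerns their
    values on the closed fluid region [y <= eta x]; what they are above the
    free surface is irrelevant. *)
Record stokes_wave (c lambda g Patm : R) (eta : R -> R)
    (u v P : R -> R -> R) : Prop := {
  sw_eta_diff : forall x, ex_derive eta x;
  sw_u_C1 : C1_on (fluid_domain eta) u;
  sw_v_C1 : C1_on (fluid_domain eta) v;
  sw_P_C1 : C1_on (fluid_domain eta) P;
  sw_u_cont : continuous_on (closed_fluid eta) (uncurry u);
  sw_v_cont : continuous_on (closed_fluid eta) (uncurry v);
  sw_P_cont : continuous_on (closed_fluid eta) (uncurry P);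
  sw_bounded : exists M, forall x y, fluid_domain eta (x, y) ->
    Rabs (u x y) <= M /\ Rabs (v x y) <= M;

  sw_euler_x : forall x y, fluid_domain eta (x, y) ->
    (u x y - c) * partial_x u x y + v x y * partial_y u x y
      = - partial_x P x y;
  sw_euler_y : forall x y, fluid_domain eta (x, y) ->
    (u x y - c) * partial_x v x y + v x y * partial_y v x y
      = - partial_y P x y - g;
  sw_incompressible : forall x y, fluid_domain eta (x, y) ->
    partial_x u x y + partial_y v x y = 0;
  sw_irrotational : forall x y, fluid_domain eta (x, y) ->
    partial_y u x y - partial_x v x y = 0;

  sw_kinematic : forall x,
    v x (eta x) = (u x (eta x) - c) * Derive eta x;
  sw_dynamic : forall x, P x (eta x) = Patm;
  sw_deep : forall eps, 0 < eps -> exists Y, forall x y,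
    fluid_domain eta (x, y) -> y < Y ->
    Rabs (u x y) < eps /\ Rabs (v x y) < eps;
  sw_no_stagnation : forall x y, closed_fluid eta (x, y) -> u x y < c;

  sw_eta_periodic : forall x, eta (x + lambda) = eta x;
  sw_periodic : forall x y, closed_fluid eta (x, y) ->
    u (x + lambda) y = u x y /\ v (x + lambda) y = v x y /\
    P (x + lambda) y = P x y;
  sw_eta_even : forall x, eta (- x) = eta x;
  sw_even : forall x y, closed_fluid eta (x, y) ->
    u (- x) y = u x y /\ P (- x) y = P x y;
  sw_eta_incr : forall x1 x2,
    - lambda / 2 <= x1 -> x1 < x2 -> x2 <= 0 -> eta x1 < eta x2;
  sw_eta_decr : forall x1 x2,
    0 <= x1 -> x1 < x2 -> x2 <= lambda / 2 -> eta x2 < eta x1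
}.

(** Continuity up to the surface ties the normalization [psi = 0] there to the
    values of [psi] inside the fluid. *)
Record is_stream_function (c : R) (eta : R -> R) (u v psi : R -> R -> R)
    : Prop := {
  sf_y : forall x y, fluid_domain eta (x, y) ->
    is_derive (fun s => psi x s) y (u x y - c);
  sf_x : forall x y, fluid_domain eta (x, y) ->
    is_derive (fun s => psi s y) x (- v x y);
  sf_cont : continuous_on (closed_fluid eta) (uncurry psi);
  sf_surface : forall x, psi x (eta x) = 0
}.

(** The streamline [y = xi_p(x)], as the set of points [(x, y)] of the closed
    fluid region with [psi x y = p]. *)
Definition on_streamline (eta : R -> R) (psi : R -> R -> R) (p x y : R)
    : Prop :=
  closed_fluid eta (x, y) /\ psi x y = p.

(** Particle paths [t |-> (X t, Y t)] in the fixed frame. *)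
Record particle_path (c : R) (eta : R -> R) (u v : R -> R -> R)
    (X Y : R -> R) : Prop := {
  pp_fluid : forall t, closed_fluid eta (X t - c * t, Y t);
  pp_x : forall t, is_derive X t (u (X t - c * t) (Y t));
  pp_y : forall t, is_derive Y t (v (X t - c * t) (Y t))
}.

(** A particle stays on its streamline in the moving frame, so one instant is
    enough to determine it. *)
Definition lies_on (c : R) (eta : R -> R) (psi : R -> R -> R) (p : R)
    (X Y : R -> R) : Prop :=
  exists t1, on_streamline eta psi p (X t1 - c * t1) (Y t1).

Definition is_time_period (c lambda : R) (eta : R -> R)
    (u v psi : R -> R -> R) (p T : R) : Prop :=
  0 < T /\
  forall (X Y : R -> R) (t0 : R),
    particle_path c eta u v X Y -> lies_on c eta psi p X Y ->
    X (T + t0) - c * T = X t0 - lambda.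

(** [iota] selects the unique real with the given property. *)
Definition time_period (c lambda : R) (eta : R -> R)
    (u v psi : R -> R -> R) (p : R) : R :=
  iota (is_time_period c lambda eta u v psi p).

Definition closed_path (X Y : R -> R) : Prop :=
  exists tau, 0 < tau /\ forall t, X (t + tau) = X t /\ Y (t + tau) = Y t.

(* Main.v *)
Require Import Defs.
From Stdlib Require Import Reals Lra ZArith.
From Coquelicot Require Import Coquelicot.
Open Scope R_scope.

(** Write [U = c - u], which is positive, and let [xi x p] be the height at [x] of
the streamline [psi = p].  In the moving frame a particle on that streamline
has horizontal velocity [- U], so it needs the time [period p], the integral of
[1 / U (x, xi x p)] over one wavelength, to travel one wavelength to the left
([path_period]); this is the time period, and the drift over it is
[c * period p - lambda].  Everything therefore reduces to
[lambda / c < period p <= period 0].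

The function [U + i v] of [x + i y] is holomorphic, with a primitive
[w = q - i p] whose real part [q] is a velocity potential and whose imaginary
part is [- psi].  The pair [(q, p)] gives coordinates on the fluid in which
every streamline is a horizontal line and one wavelength has length
[c * lambda].  In these coordinates [dz / dw = 1 / (U + i v)] is holomorphic and
periodic, the integral of its square modulus over a period of the line [p] is
[period p], and its mean is [1 / c] on every line.  Hence the square norm of
[dz / dw - 1 / c] on the line [p] is [period p - lambda / c]
([excess_period]).

For a periodic holomorphic function, the inner product of its restrictions to
the lines [p1] and [p2] depends only on [p1 + p2], because shifting the two lines
in opposite directions changes the integrand by an exact derivative
([cross_energy_midpoint]).  With the Cauchy-Schwarz inequality the square norm is
midpoint log-convex in [p] ([energy_midpoint_log_convex]).  Two elementary
consequences finish the proof.  A nonnegative, log-convex function that is bounded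
at infinity is nonincreasing ([log_convex_bounded_nonincreasing]); so [period] is
nonincreasing for [p > 0], and by continuity up to [p = 0] it is at most
[period 0].  A log-convex function with one zero vanishes identically
([log_convex_zero_everywhere]); were the excess zero somewhere, [v] would vanish
in the whole fluid, all streamlines would be horizontal, and so would the
surface, which has a crest strictly above its trough ([excess_nonzero]).  This
takes the place of analytic continuation and gives the strict inequality.

A path with positive drift is unbounded to the right in the fixed frame, so it
cannot be closed ([path_not_closed]). *)

(** * Real calculus *)

Lemma continuous_Rplus {U : UniformSpace} (f g : U -> R) (s : U) :
  continuous f s -> continuous g s -> continuous (fun t => f t + g t) s.
Proof. exact (continuous_plus f g s). Qed.

Lemma continuous_Rminus {U : UniformSpace} (f g : U -> R) (s : U) :
  continuous f s -> continuous g s -> continuous (fun t => f t - g t) s.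
Proof. exact (continuous_minus f g s). Qed.

Lemma continuous_Ropp {U : UniformSpace} (f : U -> R) (s : U) :
  continuous f s -> continuous (fun t => - f t) s.
Proof. exact (continuous_opp f s). Qed.

Lemma continuous_Rmult {U : UniformSpace} (f g : U -> R) (s : U) :
  continuous f s -> continuous g s -> continuous (fun t => f t * g t) s.
Proof. exact (continuous_mult f g s). Qed.

Lemma continuous_Rpow2 {U : UniformSpace} (f : U -> R) (s : U) :
  continuous f s -> continuous (fun t => f t ^ 2) s.
Proof.
  intros Hf. apply (continuous_comp f (fun r => r ^ 2)); [exact Hf|].
  apply (ex_derive_continuous (V := R_NormedModule)). auto_derive. exact I.
Qed.

Lemma continuous_Rdiv {U : UniformSpace} (f g : U -> R) (s : U) :
  continuous f s -> continuous g s -> g s <> 0 ->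
  continuous (fun t => f t / g t) s.
Proof.
  intros Hf Hg H0. apply continuous_Rmult; [exact Hf|].
  apply (continuous_comp g Rinv); [exact Hg|]. now apply continuous_Rinv.
Qed.

Lemma is_derive_value (f : R -> R) (x l l' : R) :
  is_derive f x l -> l = l' -> is_derive f x l'.
Proof. now intros H <-. Qed.

Lemma is_derive_Rconst (a x : R) : is_derive (fun _ : R => a) x 0.
Proof. exact (is_derive_const (V := R_NormedModule) a x). Qed.

Lemma is_derive_Rid (x : R) : is_derive (fun t : R => t) x 1.
Proof. exact (is_derive_id (K := R_AbsRing) x). Qed.

Lemma is_derive_Rplus (f g : R -> R) (x df dg : R) :
  is_derive f x df -> is_derive g x dg ->
  is_derive (fun t => f t + g t) x (df + dg).
Proof. exact (is_derive_plus f g x df dg). Qed.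

Lemma is_derive_Rminus (f g : R -> R) (x df dg : R) :
  is_derive f x df -> is_derive g x dg ->
  is_derive (fun t => f t - g t) x (df - dg).
Proof. exact (is_derive_minus f g x df dg). Qed.

Lemma is_derive_Rmult (f g : R -> R) (x df dg : R) :
  is_derive f x df -> is_derive g x dg ->
  is_derive (fun t => f t * g t) x (df * g x + f x * dg).
Proof.
  intros Hf Hg. apply (is_derive_mult f g x df dg Hf Hg), Rmult_comm.
Qed.

Lemma continuous_pair_curve {U : UniformSpace} (f : R -> R -> R) (g h : U -> R)
    (s : U) :
  continuous (fun z : R * R => f (fst z) (snd z)) (g s, h s) ->
  continuous g s -> continuous h s -> continuous (fun t => f (g t) (h t)) s.
Proof. intros Hf Hg Hh. exact (continuous_comp_2 g h f s Hg Hh Hf). Qed.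

Lemma row_continuous (f : R -> R -> R) (q p : R) :
  continuous (fun z : R * R => f (fst z) (snd z)) (q, p) ->
  continuous (fun s => f s p) q.
Proof.
  intros Hf. apply (continuous_pair_curve f (fun s => s) (fun _ => p)).
  - exact Hf.
  - apply continuous_id.
  - apply continuous_const.
Qed.

Lemma column_continuous (f : R -> R -> R) (x y : R) :
  continuous (fun z : R * R => f (fst z) (snd z)) (x, y) ->
  continuous (fun s => f x s) y.
Proof.
  intros Hf. apply (continuous_pair_curve f (fun _ => x) (fun s => s)).
  - exact Hf.
  - apply continuous_const.
  - apply continuous_id.
Qed.

Lemma is_derive_continuity_pt (f : R -> R) (x l : R) :
  is_derive f x l -> continuity_pt f x.
Proof.
  intros H. apply derivable_continuous_pt. exists l. now apply is_derive_Reals.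
Qed.

Lemma zero_derivative_constant (f : R -> R) (a b : R) :
  a <= b -> (forall x, a < x < b -> is_derive f x 0) ->
  (forall x, a <= x <= b -> continuity_pt f x) -> f b = f a.
Proof.
  intros Hab Hf Hc.
  destruct (MVT_gen f a b (fun _ => 0)) as [x [_ Hx]].
  - now rewrite Rmin_left, Rmax_right by lra.
  - now rewrite Rmin_left, Rmax_right by lra.
  - lra.
Qed.

Lemma is_derive_shift (f : R -> R) (x a l : R) :
  is_derive f (x + a) l -> is_derive (fun s => f (s + a)) x l.
Proof.
  intros Hf. apply (is_derive_value _ _ (1 * l)); [|ring].
  apply (is_derive_comp f (fun s => s + a) x l 1); [exact Hf|].
  auto_derive; [exact I | ring].
Qed.

Lemma RInt_param_continuous (f : R -> R -> R) (a b p : R) :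
  a <= b ->
  (forall x q, continuous (fun z : R * R => f (fst z) (snd z)) (x, q)) ->
  continuous (fun q => RInt (fun x => f x q) a b) p.
Proof.
  intros Hab Hf.
  assert (Hint : forall q, ex_RInt (fun x => f x q) a b).
  { intros q. apply (ex_RInt_continuous (V := R_CompleteNormedModule)).
    intros x _. now apply row_continuous. }
  apply filterlim_locally. intros eps.
  assert (He : 0 < eps / (b - a + 1)).
  { apply Rdiv_lt_0_compat; [apply cond_pos | lra]. }
  destruct (uniform_continuity_2d_1d f a b p) with (mkposreal _ He) as [d Hd].
  { intros x _. apply continuity_2d_pt_filterlim, Hf. }
  exists d. intros q Hq. change (Rabs (q - p) < d) in Hq.
  change (Rabs (RInt (fun x => f x q) a b - RInt (fun x => f x p) a b) < eps).
  assert (E : is_RInt (fun x => f x q - f x p) a b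
     (RInt (fun x => f x q) a b - RInt (fun x => f x p) a b)).
  { apply (is_RInt_minus (V := R_NormedModule));
      apply (RInt_correct (V := R_CompleteNormedModule)), Hint. }
  rewrite <- (is_RInt_unique _ _ _ _ E).
  apply Rle_lt_trans with ((b - a) * (eps / (b - a + 1))).
  - apply abs_RInt_le_const; [exact Hab | eexists; exact E |].
    intros x Hx. apply Rlt_le, (Hd x p x q); try exact Hx.
    + destruct d; simpl; lra.
    + apply Rabs_def2 in Hq. lra.
    + rewrite Rminus_diag, Rabs_R0. apply cond_pos.
  - apply Rlt_le_trans with ((b - a + 1) * (eps / (b - a + 1))).
    + apply Rmult_lt_compat_r; [exact He | lra].
    + right; field; lra.
Qed.

(** The primitive is monotone with equal end values, hence constant, and its
derivative is the integrand. *)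
Lemma RInt_zero_of_nonneg (f : R -> R) (a b : R) :
  (forall x, continuous f x) -> (forall x, 0 <= f x) -> RInt f a b = 0 ->
  forall x, a < x < b -> f x = 0.
Proof.
  intros Hc Hf Hz x Hx.
  assert (Hint : forall s t, ex_RInt f s t).
  { intros s t. apply (ex_RInt_continuous (V := R_CompleteNormedModule)).
    intros; apply Hc. }
  assert (Z : forall t, a < t < b -> RInt f a t = 0).
  { intros t Ht.
    assert (E := RInt_Chasles (V := R_CompleteNormedModule) f a t b (Hint a t) (Hint t b)).
    rewrite Hz in E. unfold plus in E; simpl in E.
    assert (0 <= RInt f a t) by (apply RInt_ge_0; [lra | apply Hint | intros; apply Hf]).
    assert (0 <= RInt f t b) by (apply RInt_ge_0; [lra | apply Hint | intros; apply Hf]).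
    lra. }
  assert (D : is_derive (fun t => RInt f a t) x (f x)).
  { apply (is_derive_RInt (V := R_NormedModule) f (fun t => RInt f a t) a).
    - apply filter_forall. intros t. apply (RInt_correct (V := R_CompleteNormedModule)), Hint.
    - apply Hc. }
  assert (D0 : is_derive (fun t => RInt f a t) x 0).
  { apply (is_derive_ext_loc (fun _ => 0)); [|apply is_derive_Rconst].
    assert (L : locally x (fun t => a < t < b)).
    { apply (open_and (fun t : R => a < t) (fun t : R => t < b));
        [apply open_gt | apply open_lt | exact Hx]. }
    revert L; apply filter_imp. intros t Ht. symmetry. now apply Z. }
  rewrite <- (is_derive_unique _ _ _ D). now apply is_derive_unique.
Qed.

(** * Periodic functions *)

Lemma quasi_periodic_Z (h : R -> R) (L K : R) :
  (forall x, h (x + L) = h x + K) ->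
  forall (k : Z) x, h (x + IZR k * L) = h x + IZR k * K.
Proof.
  intros H k. induction k as [|k IH|k IH] using Z.peano_ind; intros x.
  - rewrite !Rmult_0_l, !Rplus_0_r; reflexivity.
  - rewrite succ_IZR.
    replace (x + (IZR k + 1) * L) with (x + IZR k * L + L) by ring.
    rewrite H, IH. ring.
  - unfold Z.pred. rewrite plus_IZR.
    assert (E := H (x + (IZR k + IZR (-1)) * L)).
    replace (x + (IZR k + IZR (-1)) * L + L) with (x + IZR k * L) in E by ring.
    rewrite IH in E. lra.
Qed.

Lemma periodic_representative (f : R -> R) (L : R) :
  0 < L -> (forall x, f (x + L) = f x) ->
  forall x, exists x', - L / 2 <= x' <= L / 2 /\ f x' = f x.
Proof.
  intros HL Hf x.
  destruct (archimed (x / L - 1 / 2)) as [H1 H2].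
  set (k := up (x / L - 1 / 2)) in *.
  exists (x + IZR (- k) * L).
  assert (E : x = x / L * L) by (field; lra).
  split.
  - rewrite opp_IZR. set (r := x / L) in *. rewrite E. split; nra.
  - rewrite (quasi_periodic_Z f L 0); [ring|].
    intros y. rewrite Hf. ring.
Qed.

Lemma quasi_periodic_surjective (h : R -> R) (L K : R) :
  continuity h -> 0 < K -> (forall x, h (x + L) = h x + K) ->
  forall r, exists x, h x = r.
Proof.
  intros Hc HK H r.
  destruct (archimed ((r - h 0) / K)) as [H1 H2].
  set (k := up ((r - h 0) / K)) in *.
  assert (E := quasi_periodic_Z h L K H).
  assert (Q : r - h 0 = (r - h 0) / K * K) by (field; lra).
  set (d := (r - h 0) / K) in *.
  assert (E1 := E k 0). assert (E2 := E (k - 1)%Z 0).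
  rewrite minus_IZR in E2.
  destruct (IVT_gen h (0 + (IZR k - 1) * L) (0 + IZR k * L) r Hc) as [x [_ Hx]].
  - rewrite E1, E2, Rmin_left, Rmax_right by nra. split; nra.
  - now exists x.
Qed.

(** * Functions of two variables and inverse maps *)

(** The root is trapped between [tau s0 - eps] and [tau s0 + eps] by the signs of [G]
there, which persist near [s0] by continuity in the parameter.  This gives the continuity of the streamline heights, of
the hodograph coordinates and of the inverse of the travel time. *)
Lemma increasing_root_continuous {S : UniformSpace} (G : S -> R -> R)
    (tau : S -> R) (s0 : S) :
  (forall y, continuous (fun s => G s y) s0) ->
  locally s0 (fun s => forall y1 y2, y1 < y2 -> G s y1 < G s y2) ->
  locally s0 (fun s => G s (tau s) = 0) ->
  continuous tau s0.
Proof.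
  intros Gc Gm Gr. apply filterlim_locally. intros eps.
  assert (M0 := locally_singleton _ _ Gm). assert (R0 := locally_singleton _ _ Gr).
  cbv beta in M0, R0.
  assert (Hlo : locally s0 (fun s => G s (tau s0 - eps) < 0)).
  { apply (Gc (tau s0 - eps) (fun r => r < 0)).
    apply (open_lt 0). rewrite <- R0. apply M0. destruct eps; simpl; lra. }
  assert (Hhi : locally s0 (fun s => 0 < G s (tau s0 + eps))).
  { apply (Gc (tau s0 + eps) (fun r => 0 < r)).
    apply (open_gt 0). rewrite <- R0. apply M0. destruct eps; simpl; lra. }
  generalize (filter_and _ _ (filter_and _ _ Hlo Hhi) (filter_and _ _ Gm Gr)).
  apply filter_imp. intros s [[H1 H2] [H3 H4]].
  apply Rabs_def1; unfold minus, plus, opp; simpl.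
  - destruct (Rlt_or_le (tau s + - tau s0) eps) as [|H]; [assumption|exfalso].
    destruct (Req_dec (tau s0 + eps) (tau s)) as [E|E].
    + rewrite E in H2; lra.
    + assert (G s (tau s0 + eps) < G s (tau s)) by (apply H3; lra). lra.
  - destruct (Rlt_or_le (- eps) (tau s + - tau s0)) as [|H]; [assumption|exfalso].
    destruct (Req_dec (tau s) (tau s0 - eps)) as [E|E].
    + rewrite <- E in H1; lra.
    + assert (G s (tau s) < G s (tau s0 - eps)) by (apply H3; lra). lra.
Qed.

Lemma is_derive_eps (f : R -> R) (x l : R) :
  is_derive f x l <->
  forall eps : posreal, locally x (fun t =>
    Rabs (f t - f x - l * (t - x)) <= eps * Rabs (t - x)).
Proof.
  split.
  - intros [_ H] eps.
    generalize (H x (fun P HP => HP) eps). apply filter_imp. intros t Ht.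
    unfold norm, minus, plus, opp, scal in Ht; simpl in Ht.
    unfold abs, mult in Ht; simpl in Ht.
    replace (f t - f x - l * (t - x)) with (f t + - f x + - ((t + - x) * l)) by ring.
    exact Ht.
  - intros H. split; [apply is_linear_scal_l|].
    intros x' Hx' eps.
    rewrite <- (is_filter_lim_locally_unique _ _ Hx').
    generalize (H eps). apply filter_imp. intros t Ht.
    unfold norm, minus, plus, opp, scal; simpl.
    unfold abs, mult; simpl.
    replace (f t + - f x + - ((t + - x) * l)) with (f t - f x - l * (t - x)) by ring.
    exact Ht.
Qed.

Lemma locally_2d_curve (Q : R -> R -> Prop) (x y : R -> R) (s0 : R) :
  continuous x s0 -> continuous y s0 -> locally_2d Q (x s0) (y s0) ->
  locally s0 (fun s => Q (x s) (y s)).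
Proof.
  intros Hx Hy [d Hd].
  generalize (filter_and _ _
    (proj1 (filterlim_locally x (x s0)) Hx d)
    (proj1 (filterlim_locally y (y s0)) Hy d)).
  apply filter_imp. intros s [H1 H2]. apply Hd; assumption.
Qed.

(** Differentiability of the inverse of a plane map, tested along a curve: the images
[F (x, y)] and [G (x, y)] of the curve are differentiable and the curve is known to
be continuous.  Solving the two linearized equations bounds the increment
of the curve by a multiple of [s - s0]; this turns the error terms, which are
small relative to that increment, into errors small relative to [s - s0].
Taking a coordinate function for [F] or [G] gives the implicit function theorem. *)
Lemma inverse_map_derive (F G : R -> R -> R) (x y : R -> R)
    (s0 k1 k2 Fx Fy Gx Gy : R) :
  differentiable_pt_lim F (x s0) (y s0) Fx Fy ->
  differentiable_pt_lim G (x s0) (y s0) Gx Gy ->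
  continuous x s0 -> continuous y s0 ->
  is_derive (fun s => F (x s) (y s)) s0 k1 ->
  is_derive (fun s => G (x s) (y s)) s0 k2 ->
  Fx * Gy - Fy * Gx <> 0 ->
  is_derive x s0 ((k1 * Gy - k2 * Fy) / (Fx * Gy - Fy * Gx)) /\
  is_derive y s0 ((k2 * Fx - k1 * Gx) / (Fx * Gy - Fy * Gx)).
Proof.
  intros HF HG Hx Hy DF DG Hdet.
  set (det := Fx * Gy - Fy * Gx) in *.
  set (lx := k1 * Gy - k2 * Fy). set (ly := k2 * Fx - k1 * Gx).
  pose (K := Rabs Fx + Rabs Fy + Rabs Gx + Rabs Gy + 1).
  pose (M := fun s => Rmax (Rabs (x s - x s0)) (Rabs (y s - y s0))).
  assert (K_pos : 1 <= K).
  { unfold K. generalize (Rabs_pos Fx) (Rabs_pos Fy) (Rabs_pos Gx) (Rabs_pos Gy).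
    lra. }
  assert (det_pos : 0 < Rabs det) by now apply Rabs_pos_lt.
  assert (Est : forall eps : posreal, locally s0 (fun s =>
     Rabs (det * (x s - x s0) - lx * (s - s0)) <= K * eps * (M s + Rabs (s - s0)) /\
     Rabs (det * (y s - y s0) - ly * (s - s0)) <= K * eps * (M s + Rabs (s - s0)))).
  { intros eps.
    generalize (filter_and _ _
      (filter_and _ _ (locally_2d_curve _ x y s0 Hx Hy (HF eps))
                      (locally_2d_curve _ x y s0 Hx Hy (HG eps)))
      (filter_and _ _ (proj1 (is_derive_eps _ _ _) DF eps)
                      (proj1 (is_derive_eps _ _ _) DG eps))).
    apply filter_imp. intros s [[H1 H2] [H3 H4]].
    fold (M s) in H1, H2.
    set (ds := s - s0) in *. set (dx := x s - x s0) in *. set (dy := y s - y s0) in *.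
    set (dF := F (x s) (y s) - F (x s0) (y s0)) in *.
    set (dG := G (x s) (y s) - G (x s0) (y s0)) in *.
    assert (E1 : Rabs (k1 * ds - (Fx * dx + Fy * dy)) <= eps * (M s + Rabs ds)).
    { replace (k1 * ds - (Fx * dx + Fy * dy))
        with ((dF - (Fx * dx + Fy * dy)) - (dF - k1 * ds)) by ring.
      eapply Rle_trans; [apply Rabs_triang|]. rewrite Rabs_Ropp. lra. }
    assert (E2 : Rabs (k2 * ds - (Gx * dx + Gy * dy)) <= eps * (M s + Rabs ds)).
    { replace (k2 * ds - (Gx * dx + Gy * dy))
        with ((dG - (Gx * dx + Gy * dy)) - (dG - k2 * ds)) by ring.
      eapply Rle_trans; [apply Rabs_triang|]. rewrite Rabs_Ropp. lra. }
    set (e := eps * (M s + Rabs ds)) in *.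
    assert (He : 0 <= e) by (eapply Rle_trans; [apply Rabs_pos | exact E1]).
    assert (Comb : forall a b r1 r2, Rabs r1 <= e -> Rabs r2 <= e ->
      Rabs a + Rabs b <= K -> Rabs (a * r1 + b * r2) <= K * e).
    { intros a b r1 r2 R1 R2 Hab.
      eapply Rle_trans; [apply Rabs_triang|]. rewrite !Rabs_mult.
      generalize (Rabs_pos a) (Rabs_pos b) (Rabs_pos r1) (Rabs_pos r2). intros.
      apply Rle_trans with ((Rabs a + Rabs b) * e); [|nra].
      nra. }
    rewrite !Rmult_assoc. fold e. split.
    - replace (det * dx - lx * ds) with
        ((- Gy) * (k1 * ds - (Fx * dx + Fy * dy))
         + Fy * (k2 * ds - (Gx * dx + Gy * dy))) by (unfold det, lx; ring).
      apply Comb; [exact E1 | exact E2 |].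
      rewrite Rabs_Ropp; unfold K.
      generalize (Rabs_pos Fx) (Rabs_pos Gx); lra.
    - replace (det * dy - ly * ds) with
        (Gx * (k1 * ds - (Fx * dx + Fy * dy))
         + (- Fx) * (k2 * ds - (Gx * dx + Gy * dy))) by (unfold det, ly; ring).
      apply Comb; [exact E1 | exact E2 |].
      rewrite Rabs_Ropp; unfold K.
      generalize (Rabs_pos Fy) (Rabs_pos Gy); lra. }
  pose (C := 2 * (Rabs lx + Rabs ly) / Rabs det + 1).
  assert (C_pos : 1 <= C).
  { unfold C. assert (0 <= 2 * (Rabs lx + Rabs ly) / Rabs det); [|lra].
    apply Rdiv_le_0_compat; [|exact det_pos].
    generalize (Rabs_pos lx) (Rabs_pos ly); lra. }
  assert (Lip : locally s0 (fun s => M s <= C * Rabs (s - s0))).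
  { assert (He : 0 < Rabs det / (2 * K)) by (apply Rdiv_lt_0_compat; lra).
    generalize (Est (mkposreal _ He)). apply filter_imp. intros s [H1 H2].
    simpl in H1, H2.
    replace (K * (Rabs det / (2 * K))) with (Rabs det / 2) in H1, H2 by (field; lra).
    assert (T : forall l d, Rabs l <= Rabs lx + Rabs ly ->
      Rabs (det * d - l * (s - s0)) <= Rabs det / 2 * (M s + Rabs (s - s0)) ->
      Rabs det * Rabs d <= (Rabs lx + Rabs ly) * Rabs (s - s0)
                           + Rabs det / 2 * (M s + Rabs (s - s0))).
    { intros l d Hl Hd. rewrite <- Rabs_mult.
      replace (det * d) with (l * (s - s0) + (det * d - l * (s - s0))) by ring.
      eapply Rle_trans; [apply Rabs_triang|]. apply Rplus_le_compat; [|exact Hd].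
      rewrite Rabs_mult. apply Rmult_le_compat_r; [apply Rabs_pos | exact Hl]. }
    apply T in H1; [|generalize (Rabs_pos ly); lra].
    apply T in H2; [|generalize (Rabs_pos lx); lra].
    assert (HM : Rabs det * M s <= (Rabs lx + Rabs ly) * Rabs (s - s0)
                           + Rabs det / 2 * (M s + Rabs (s - s0))).
    { unfold M at 1. unfold Rmax at 1. destruct (Rle_dec _ _); assumption. }
    apply Rmult_le_reg_l with (Rabs det / 2); [lra|].
    unfold C.
    replace (Rabs det / 2 * ((2 * (Rabs lx + Rabs ly) / Rabs det + 1) * Rabs (s - s0)))
      with ((Rabs lx + Rabs ly) * Rabs (s - s0) + Rabs det / 2 * Rabs (s - s0))
      by (field; lra).
    lra. }
  assert (Fin : forall eps : posreal, locally s0 (fun s =>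
     Rabs (x s - x s0 - lx / det * (s - s0)) <= eps * Rabs (s - s0) /\
     Rabs (y s - y s0 - ly / det * (s - s0)) <= eps * Rabs (s - s0))).
  { intros eps.
    assert (He : 0 < eps * Rabs det / (K * (C + 1))).
    { apply Rdiv_lt_0_compat; [|nra].
      apply Rmult_lt_0_compat; [apply cond_pos | exact det_pos]. }
    generalize (filter_and _ _ Lip (Est (mkposreal _ He))).
    apply filter_imp. intros s [HL [H1 H2]]. simpl in H1, H2.
    replace (K * (eps * Rabs det / (K * (C + 1))))
      with (eps * Rabs det / (C + 1)) in H1, H2 by (field; lra).
    assert (B : eps * Rabs det / (C + 1) * (M s + Rabs (s - s0))
                <= Rabs det * (eps * Rabs (s - s0))).
    { replace (Rabs det * (eps * Rabs (s - s0)))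
        with (eps * Rabs det / (C + 1) * (C * Rabs (s - s0) + Rabs (s - s0)))
        by (field; lra).
      apply Rmult_le_compat_l; [|lra].
      apply Rdiv_le_0_compat; [|lra].
      apply Rmult_le_pos; [apply Rlt_le, cond_pos | lra]. }
    assert (T : forall l d, Rabs (det * d - l * (s - s0))
         <= eps * Rabs det / (C + 1) * (M s + Rabs (s - s0)) ->
       Rabs (d - l / det * (s - s0)) <= eps * Rabs (s - s0)).
    { intros l d Hd. apply Rmult_le_reg_l with (Rabs det); [exact det_pos|].
      rewrite <- Rabs_mult.
      replace (det * (d - l / det * (s - s0))) with (det * d - l * (s - s0))
        by (field; exact Hdet).
      lra. }
    split; apply T; assumption. }
  split; apply is_derive_eps; intros eps; generalize (Fin eps);
    apply filter_imp; intros s [H1 H2]; assumption.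
Qed.

Lemma differentiable_pt_lim_snd (x y : R) :
  differentiable_pt_lim (fun _ t => t) x y 0 1.
Proof.
  intros eps. apply locally_2d_forall. intros a b.
  replace (b - y - (0 * (a - x) + 1 * (b - y))) with 0 by ring.
  rewrite Rabs_R0. apply Rmult_le_pos; [apply Rlt_le, cond_pos|].
  eapply Rle_trans; [apply Rabs_pos | apply Rmax_l].
Qed.

Lemma differentiable_pt_lim_fst (x y : R) :
  differentiable_pt_lim (fun t _ => t) x y 1 0.
Proof.
  intros eps. apply locally_2d_forall. intros a b.
  replace (a - x - (1 * (a - x) + 0 * (b - y))) with 0 by ring.
  rewrite Rabs_R0. apply Rmult_le_pos; [apply Rlt_le, cond_pos|].
  eapply Rle_trans; [apply Rabs_pos | apply Rmax_l].
Qed.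

Lemma differentiable_of_partials (f fx fy : R -> R -> R) (x y : R) :
  locally_2d (fun a b => is_derive (fun s => f s b) a (fx a b)) x y ->
  is_derive (fun s => f x s) y (fy x y) ->
  continuous (fun z : R * R => fx (fst z) (snd z)) (x, y) ->
  differentiable_pt_lim f x y (fx x y) (fy x y).
Proof.
  intros Hx Hy Hc. apply filterdiff_differentiable_pt_lim.
  apply (is_derive_filterdiff f x y fx (fy x y)).
  - exact (proj1 (locally_2d_locally _ _ _) Hx).
  - exact Hy.
  - exact Hc.
Qed.

(** The real and imaginary parts of the derivative of [f = 1 / (U + i v)], where
[U = c - u]: that derivative is [(du - i dv) * f ^ 2]. *)
Lemma inverse_velocity_derive (c : R) (u' v' : R -> R) (t du dv : R) :
  is_derive u' t du -> is_derive v' t dv -> 0 < (c - u' t) ^ 2 + v' t ^ 2 ->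
  let S := (c - u' t) ^ 2 + v' t ^ 2 in
  is_derive (fun t => (c - u' t) / ((c - u' t) ^ 2 + v' t ^ 2)) t
    (du * (((c - u' t) / S) ^ 2 - (- v' t / S) ^ 2)
     + dv * (2 * ((c - u' t) / S) * (- v' t / S))) /\
  is_derive (fun t => - v' t / ((c - u' t) ^ 2 + v' t ^ 2)) t
    (du * (2 * ((c - u' t) / S) * (- v' t / S))
     - dv * (((c - u' t) / S) ^ 2 - (- v' t / S) ^ 2)).
Proof.
  intros Hu Hv H S. unfold S.
  assert (Eu : ex_derive u' t) by (eexists; exact Hu).
  assert (Ev : ex_derive v' t) by (eexists; exact Hv).
  split; auto_derive;
    try (repeat split; trivial; apply Rgt_not_eq; lra);
    replace (Derive (fun x => u' x) t) with du by (symmetry; now apply is_derive_unique);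
    replace (Derive (fun x => v' x) t) with dv by (symmetry; now apply is_derive_unique);
    field; lra.
Qed.

(** * Energy of a holomorphic function on horizontal lines *)

(** The discriminant inequality, including the degenerate case [k = 0], which forces
[b = 0]. *)
Lemma square_le_product_of_quadratic (a b k : R) :
  (forall t, 0 <= a - 2 * t * b + t * t * k) -> b * b <= a * k.
Proof.
  intros H.
  assert (Hk : 0 <= k).
  { destruct (Rle_or_lt 0 k) as [Hk|Hk]; [exact Hk|exfalso].
    (* For negative [k] the quadratic is negative at this large [t]. *)
    pose (t := 1 + (Rabs a + 2 * Rabs b) / (- k)).
    assert (Ht : (t - 1) * (- k) = Rabs a + 2 * Rabs b)
      by (unfold t; field; lra).
    assert (Ht1 : 1 <= t).
    { assert (0 <= (Rabs a + 2 * Rabs b) / (- k)); [|unfold t; lra].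
      apply Rdiv_le_0_compat; [|lra].
      generalize (Rabs_pos a) (Rabs_pos b); lra. }
    specialize (H t).
    assert (H1 := Rle_abs a). assert (H2 := Rle_abs (- b)).
    rewrite Rabs_Ropp in H2. assert (H3 := Rabs_pos a).
    nra. }
  destruct (Req_dec k 0) as [->|Hk0].
  - assert (Hb : b = 0).
    { destruct (Req_dec b 0) as [|Hb]; [assumption|exfalso].
      specialize (H ((a + 1) / (2 * b))).
      replace (a - 2 * ((a + 1) / (2 * b)) * b
               + (a + 1) / (2 * b) * ((a + 1) / (2 * b)) * 0) with (-1) in H
        by (field; exact Hb).
      lra. }
    rewrite Hb; lra.
  - specialize (H (b / k)).
    replace (a - 2 * (b / k) * b + b / k * (b / k) * k)
      with ((a * k - b * b) / k) in H by (field; exact Hk0).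
    apply Rmult_le_compat_r with (r := k) in H; [|exact Hk].
    replace ((a * k - b * b) / k * k) with (a * k - b * b) in H
      by (field; exact Hk0).
    lra.
Qed.

(** The hypotheses say that [re + i im] is, on the half-plane [p > 0], a function of
class C1 that is periodic in [q] and satisfies the Cauchy-Riemann equations in the
variable [q - i p] (the sign comes from [p] growing downwards in the fluid). *)
Section HolomorphicEnergy.

Variables (L : R) (re im re_q im_q : R -> R -> R).
Hypothesis L_pos : 0 < L.
Hypothesis re_dq : forall q p, 0 < p -> is_derive (fun s => re s p) q (re_q q p).
Hypothesis im_dq : forall q p, 0 < p -> is_derive (fun s => im s p) q (im_q q p).
Hypothesis re_dp : forall q p, 0 < p -> is_derive (fun s => re q s) p (im_q q p).
Hypothesis im_dp : forall q p, 0 < p -> is_derive (fun s => im q s) p (- re_q q p).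
Hypothesis re_cont : forall q p, 0 < p ->
  continuous (fun z : R * R => re (fst z) (snd z)) (q, p).
Hypothesis im_cont : forall q p, 0 < p ->
  continuous (fun z : R * R => im (fst z) (snd z)) (q, p).
Hypothesis re_q_cont : forall q p, 0 < p ->
  continuous (fun z : R * R => re_q (fst z) (snd z)) (q, p).
Hypothesis im_q_cont : forall q p, 0 < p ->
  continuous (fun z : R * R => im_q (fst z) (snd z)) (q, p).
Hypothesis re_per : forall p, 0 < p -> re L p = re 0 p.
Hypothesis im_per : forall p, 0 < p -> im L p = im 0 p.

Definition cross_energy (p1 p2 : R) : R :=
  RInt (fun q => re q p1 * re q p2 + im q p1 * im q p2) 0 L.

Lemma cross_integrand_continuous (p1 p2 q : R) : 0 < p1 -> 0 < p2 ->
  continuous (fun q => re q p1 * re q p2 + im q p1 * im q p2) q.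
Proof.
  intros H1 H2.
  apply continuous_Rplus; apply continuous_Rmult; apply row_continuous; auto.
Qed.

Lemma cross_integrable (p1 p2 : R) : 0 < p1 -> 0 < p2 ->
  ex_RInt (fun q => re q p1 * re q p2 + im q p1 * im q p2) 0 L.
Proof.
  intros H1 H2. apply (ex_RInt_continuous (V := R_CompleteNormedModule)).
  intros q _. now apply cross_integrand_continuous.
Qed.

(** Moving one line up and the other down by the same amount changes the integrand,
by the Cauchy-Riemann equations, by the [q]-derivative of a periodic function. *)
Lemma cross_energy_derive (m s : R) : - m < s < m ->
  is_derive (fun s => cross_energy (m - s) (m + s)) s 0.
Proof.
  intros Hs.
  (* By the Cauchy-Riemann equations this [s]-derivative of the integrand is also the
     [q]-derivative of [F] below. *)
  pose (df := fun s q =>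
    (re_q q (m - s) * im q (m + s) + re q (m - s) * im_q q (m + s))
     - (im_q q (m - s) * re q (m + s) + im q (m - s) * re_q q (m + s))).
  pose (f := fun s q => re q (m - s) * re q (m + s) + im q (m - s) * im q (m + s)).
  assert (Hnear : locally s (fun s' => - m < s' < m)).
  { apply (open_and (fun s' : R => - m < s') (fun s' : R => s' < m));
      [apply open_gt | apply open_lt | exact Hs]. }
  assert (Hf : forall s' q, - m < s' < m -> is_derive (fun s => f s q) s' (df s' q)).
  { intros s' q Hs'. unfold f.
    assert (D1 : forall (g : R -> R) l, is_derive g (m - s') l ->
              is_derive (fun s => g (m - s)) s' (-1 * l)).
    { intros g l Hg.
      apply (is_derive_comp g (fun s => m - s) s' l (-1)); [exact Hg|].
      auto_derive; [exact I|ring]. }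
    assert (D2 : forall (g : R -> R) l, is_derive g (m + s') l ->
              is_derive (fun s => g (m + s)) s' (1 * l)).
    { intros g l Hg.
      apply (is_derive_comp g (fun s => m + s) s' l 1); [exact Hg|].
      auto_derive; [exact I|ring]. }
    eapply is_derive_value.
    - apply is_derive_Rplus; apply is_derive_Rmult.
      + apply (D1 (fun s => re q s)); apply re_dp; lra.
      + apply (D2 (fun s => re q s)); apply re_dp; lra.
      + apply (D1 (fun s => im q s)); apply im_dp; lra.
      + apply (D2 (fun s => im q s)); apply im_dp; lra.
    - unfold df; ring. }
  assert (Hint : RInt (fun q => Derive (fun s => f s q) s) 0 L = 0).
  { rewrite (RInt_ext _ (df s)).
    2:{ intros q _. apply is_derive_unique, Hf, Hs. }
    pose (F := fun q => re q (m - s) * im q (m + s) - im q (m - s) * re q (m + s)).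
    assert (G1 : 0 < m - s) by lra. assert (G2 : 0 < m + s) by lra.
    assert (HF : is_RInt (df s) 0 L (minus (F L) (F 0))).
    { apply (is_RInt_derive F (df s)).
      - intros q _. unfold F, df. eapply is_derive_value.
        + apply is_derive_Rminus; apply is_derive_Rmult.
          * exact (re_dq q _ G1).
          * exact (im_dq q _ G2).
          * exact (im_dq q _ G1).
          * exact (re_dq q _ G2).
        + cbv beta; ring.
      - intros q _. unfold df.
        apply continuous_Rminus; apply continuous_Rplus; apply continuous_Rmult;
          apply row_continuous; auto. }
    rewrite (is_RInt_unique _ _ _ _ HF). unfold F, minus, plus, opp; simpl.
    rewrite !re_per, !im_per by lra. ring. }
  rewrite <- Hint.
  apply (is_derive_RInt_param f 0 L s).
  - revert Hnear; apply filter_imp; intros s' Hs' q _.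
    exists (df s' q); now apply Hf.
  - intros q _.
    apply continuity_2d_pt_ext_loc with df.
    + apply locally_2d_locally.
      destruct Hnear as [d Hd]. exists d. intros [s' q'] [B1 _].
      simpl. symmetry. apply is_derive_unique, Hf, Hd, B1.
    + apply continuity_2d_pt_filterlim.
      assert (C1 : forall g : R -> R -> R,
        continuous (fun z : R * R => g (fst z) (snd z)) (q, m - s) ->
        continuous (fun z : R * R => g (snd z) (m - fst z)) (s, q)).
      { intros g Hg.
        apply (continuous_pair_curve g (fun z : R * R => snd z)
                 (fun z : R * R => m - fst z)).
        - exact Hg.
        - apply continuous_snd.
        - apply continuous_Rminus; [apply continuous_const | apply continuous_fst]. }
      assert (C2 : forall g : R -> R -> R,
        continuous (fun z : R * R => g (fst z) (snd z)) (q, m + s) ->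
        continuous (fun z : R * R => g (snd z) (m + fst z)) (s, q)).
      { intros g Hg.
        apply (continuous_pair_curve g (fun z : R * R => snd z)
                 (fun z : R * R => m + fst z)).
        - exact Hg.
        - apply continuous_snd.
        - apply continuous_Rplus; [apply continuous_const | apply continuous_fst]. }
      assert (G1 : 0 < m - s) by lra. assert (G2 : 0 < m + s) by lra.
      change (continuous (fun z : R * R => df (fst z) (snd z)) (s, q)).
      unfold df.
      apply continuous_Rminus; apply continuous_Rplus; apply continuous_Rmult.
      * exact (C1 re_q (re_q_cont _ _ G1)).
      * exact (C2 im (im_cont _ _ G2)).
      * exact (C1 re (re_cont _ _ G1)).
      * exact (C2 im_q (im_q_cont _ _ G2)).
      * exact (C1 im_q (im_q_cont _ _ G1)).
      * exact (C2 re (re_cont _ _ G2)).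
      * exact (C1 im (im_cont _ _ G1)).
      * exact (C2 re_q (re_q_cont _ _ G2)).
  - revert Hnear; apply filter_imp; intros s' Hs'.
    apply (cross_integrable (m - s') (m + s')); lra.
Qed.

Lemma cross_energy_midpoint (p1 p2 : R) : 0 < p1 -> p1 <= p2 ->
  cross_energy p1 p2 = cross_energy ((p1 + p2) / 2) ((p1 + p2) / 2).
Proof.
  (* The lines are [m - s] and [m + s] with [s] running from 0 to [h]. *)
  intros H1 H2. pose (m := (p1 + p2) / 2). pose (h := (p2 - p1) / 2).
  assert (E := zero_derivative_constant
    (fun s => cross_energy (m - s) (m + s)) 0 h).
  cbv beta in E.
  replace (m - h) with p1 in E by (unfold m, h; field).
  replace (m + h) with p2 in E by (unfold m, h; field).
  rewrite Rminus_0_r, Rplus_0_r in E.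
  assert (D : forall s, 0 <= s <= h ->
    is_derive (fun s => cross_energy (m - s) (m + s)) s 0).
  { intros s Hs. apply cross_energy_derive. unfold m; unfold h in Hs; lra. }
  apply E.
  - unfold h; lra.
  - intros s Hs. apply D; lra.
  - intros s Hs. apply (is_derive_continuity_pt _ s 0), D, Hs.
Qed.

Lemma cross_energy_Cauchy_Schwarz (p1 p2 : R) : 0 < p1 -> 0 < p2 ->
  cross_energy p1 p2 * cross_energy p1 p2
    <= cross_energy p1 p1 * cross_energy p2 p2.
Proof.
  intros H1 H2. apply square_le_product_of_quadratic. intros t.
  assert (I : is_RInt (fun q => (re q p1 - t * re q p2) ^ 2
                              + (im q p1 - t * im q p2) ^ 2) 0 L
     (cross_energy p1 p1 - 2 * t * cross_energy p1 p2
        + t * t * cross_energy p2 p2)).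
  { apply (is_RInt_ext (fun q =>
      plus (minus (re q p1 * re q p1 + im q p1 * im q p1)
         (scal (2 * t) (re q p1 * re q p2 + im q p1 * im q p2)))
         (scal (t * t) (re q p2 * re q p2 + im q p2 * im q p2)))).
    { intros q _. unfold plus, minus, scal, opp, plus; simpl.
      unfold mult; simpl. ring. }
    apply (is_RInt_plus (V := R_NormedModule)).
    - apply (is_RInt_minus (V := R_NormedModule)).
      + apply (RInt_correct (V := R_CompleteNormedModule)), cross_integrable; auto.
      + apply (is_RInt_scal (V := R_NormedModule)).
        apply (RInt_correct (V := R_CompleteNormedModule)), cross_integrable; auto.
    - apply (is_RInt_scal (V := R_NormedModule)).
      apply (RInt_correct (V := R_CompleteNormedModule)), cross_integrable; auto. }
  rewrite <- (is_RInt_unique _ _ _ _ I).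
  apply RInt_ge_0; [lra | eexists; exact I | intros q _].
  apply Rplus_le_le_0_compat; apply pow2_ge_0.
Qed.

Lemma energy_midpoint_log_convex (p1 p2 : R) : 0 < p1 -> 0 < p2 ->
  cross_energy ((p1 + p2) / 2) ((p1 + p2) / 2)
    * cross_energy ((p1 + p2) / 2) ((p1 + p2) / 2)
    <= cross_energy p1 p1 * cross_energy p2 p2.
Proof.
  intros H1 H2. destruct (Rle_or_lt p1 p2) as [H|H].
  - rewrite <- cross_energy_midpoint by lra.
    now apply cross_energy_Cauchy_Schwarz.
  - replace (p1 + p2) with (p2 + p1) by ring.
    rewrite Rmult_comm with (r1 := cross_energy p1 p1).
    rewrite <- cross_energy_midpoint by lra.
    now apply cross_energy_Cauchy_Schwarz.
Qed.

Lemma energy_nonneg (p : R) : 0 < p -> 0 <= cross_energy p p.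
Proof.
  intros Hp. apply RInt_ge_0; [lra | now apply cross_integrable | intros q _].
  apply Rplus_le_le_0_compat; apply Rle_0_sqr.
Qed.

End HolomorphicEnergy.

Section LogConvex.

Variable N : R -> R.
Hypothesis N_nonneg : forall p, 0 < p -> 0 <= N p.
Hypothesis N_log_convex : forall p1 p2, 0 < p1 -> 0 < p2 ->
  N ((p1 + p2) / 2) * N ((p1 + p2) / 2) <= N p1 * N p2.

(** If [N p1 < N p2], the ratios of consecutive values along the arithmetic
progression starting with [p1], [p2] never decrease, so [N] grows geometrically
along it and is unbounded. *)
Lemma log_convex_bounded_nonincreasing (B P0 : R) :
  (forall p, P0 <= p -> N p <= B) ->
  forall p1 p2, 0 < p1 -> p1 <= p2 -> N p2 <= N p1.
Proof.
  intros HB p1 p2 H1 H12.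
  destruct (Rle_or_lt (N p2) (N p1)) as [H|H]; [exact H|exfalso].
  assert (Hlt : p1 < p2) by (destruct H12 as [|E]; [assumption | rewrite E in H; lra]).
  pose (d := p2 - p1).
  assert (N1 : 0 < N p1).
  { assert (H' := N_nonneg p1 H1). destruct H' as [|E]; [assumption|exfalso].
    assert (C := N_log_convex p1 (p2 + d)). unfold d in C.
    replace ((p1 + (p2 + (p2 - p1))) / 2) with p2 in C by field.
    rewrite <- E in C. assert (0 < N p2 * N p2) by nra.
    assert (C' : N p2 * N p2 <= 0 * N (p2 + (p2 - p1))) by (apply C; lra). lra. }
  pose (r := N p2 / N p1).
  assert (Hr : 1 < r).
  { unfold r. apply Rmult_lt_reg_r with (N p1); [exact N1|].
    unfold Rdiv. rewrite Rmult_assoc, Rinv_l by lra. lra. }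
  assert (Step : forall n, 0 < N (p1 + INR n * d)
             /\ r * N (p1 + INR n * d) <= N (p1 + INR (S n) * d)).
  { induction n as [|n [IH1 IH2]].
    - simpl. rewrite Rmult_0_l, Rplus_0_r. split; [exact N1|].
      replace (p1 + 1 * d) with p2 by (unfold d; ring).
      unfold r, Rdiv. rewrite Rmult_assoc, Rinv_l; lra.
    - assert (Hpos : 0 < N (p1 + INR (S n) * d)) by nra.
      split; [exact Hpos|].
      assert (0 <= INR n) by apply pos_INR.
      assert (C := N_log_convex (p1 + INR n * d) (p1 + INR (S (S n)) * d)).
      rewrite !S_INR in *.
      replace ((p1 + INR n * d + (p1 + (INR n + 1 + 1) * d)) / 2)
        with (p1 + (INR n + 1) * d) in C by field.
      assert (0 < d) by (unfold d; lra).
      assert (C' := C ltac:(nra) ltac:(nra)).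
      apply Rmult_le_reg_l with (N (p1 + INR n * d)); [exact IH1|].
      nra. }
  assert (Grow : forall n, N p1 * (1 + INR n * (r - 1)) <= N (p1 + INR n * d)).
  { induction n as [|n IH].
    - simpl. rewrite !Rmult_0_l, !Rplus_0_r. lra.
    - destruct (Step n) as [_ S2]. apply Rle_trans with (2 := S2).
      rewrite S_INR. assert (0 <= INR n) by apply pos_INR.
      apply Rle_trans with (r * (N p1 * (1 + INR n * (r - 1)))); [|nra].
      assert (0 <= N p1 * INR n * ((r - 1) * (r - 1))).
      { apply Rmult_le_pos; [|nra]. apply Rmult_le_pos; lra. }
      nra. }
  destruct (INR_unbounded (Rmax (P0 / d) (B / (N p1 * (r - 1))))) as [n Hn].
  assert (d_pos : 0 < d) by (unfold d; lra).
  assert (HP : P0 <= p1 + INR n * d).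
  { assert (P0 / d < INR n) by (eapply Rle_lt_trans; [apply Rmax_l | exact Hn]).
    apply Rmult_lt_compat_r with (r := d) in H0; [|exact d_pos].
    replace (P0 / d * d) with P0 in H0 by (field; lra). lra. }
  assert (HB' : B < INR n * (N p1 * (r - 1))).
  { assert (K : 0 < N p1 * (r - 1)) by nra.
    assert (H0 : B / (N p1 * (r - 1)) < INR n)
      by (eapply Rle_lt_trans; [apply Rmax_r | exact Hn]).
    apply Rmult_lt_compat_r with (r := N p1 * (r - 1)) in H0; [|exact K].
    unfold Rdiv in H0. rewrite Rmult_assoc, Rinv_l in H0 by lra. lra. }
  assert (G := Grow n). assert (B1 := HB _ HP). nra.
Qed.

(** A zero at [a] is the left or right end of a segment with any given midpoint
beyond [a / 2], so the zero set contains all [p > a / 2]; halving repeatedly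
reaches every [p > 0]. *)
Lemma log_convex_zero_everywhere (r : R) :
  0 < r -> N r = 0 -> forall p, 0 < p -> N p = 0.
Proof.
  intros Hr Zr.
  assert (Prop1 : forall a p, 0 < a -> N a = 0 -> a / 2 < p -> N p = 0).
  { intros a p Ha Za Hp.
    assert (C := N_log_convex a (2 * p - a) Ha ltac:(lra)).
    replace ((a + (2 * p - a)) / 2) with p in C by field.
    rewrite Za, Rmult_0_l in C. nra. }
  assert (All : forall n p, r / 2 ^ n < p -> N p = 0).
  { induction n as [|n IH]; intros p Hp.
    - apply (Prop1 r); auto. simpl in Hp. lra.
    - assert (0 < 2 ^ n) by (apply pow_lt; lra).
      assert (0 < r / 2 ^ n) by (apply Rdiv_lt_0_compat; lra).
      simpl in Hp. replace (r / (2 * 2 ^ n)) with (r / 2 ^ n / 2) in Hp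
        by (field; lra).
      apply (Prop1 ((r / 2 ^ n + 2 * p) / 2)); [lra | apply IH; lra | lra]. }
  intros p Hp.
  destruct (INR_unbounded (r / p)) as [n Hn].
  apply (All n).
  assert (H2 : INR n < 2 ^ n).
  { clear. induction n as [|n IH]; [simpl; lra|].
    rewrite S_INR. simpl. assert (1 <= 2 ^ n) by (apply pow_R1_Rle; lra). lra. }
  assert (0 < 2 ^ n) by (apply pow_lt; lra).
  apply Rmult_lt_reg_r with (2 ^ n); [assumption|].
  replace (r / 2 ^ n * 2 ^ n) with r by (field; lra).
  assert (r / p * p < 2 ^ n * p) by (apply Rmult_lt_compat_r; lra).
  replace (r / p * p) with r in * by (field; lra). lra.
Qed.

End LogConvex.

(** * Stream function and streamlines *)

Section Wave.

Variables (c lambda g Patm : R) (eta : R -> R) (u v P psi : R -> R -> R).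
Hypothesis hc : 0 < c.
Hypothesis hlambda : 0 < lambda.
Hypothesis hwave : stokes_wave c lambda g Patm eta u v P.
Hypothesis hpsi : is_stream_function c eta u v psi.

Lemma eta_continuous (x : R) : continuous eta x.
Proof.
  apply (ex_derive_continuous (V := R_NormedModule)).
  apply (sw_eta_diff _ _ _ _ _ _ _ _ hwave).
Qed.

Lemma fluid_domain_open (x y : R) : y < eta x ->
  locally (x, y) (fluid_domain eta).
Proof.
  intros H. unfold fluid_domain.
  assert (Hc : continuous (fun z : R * R => eta (fst z) - snd z) (x, y)).
  { apply continuous_Rminus; [|apply continuous_snd].
    apply (continuous_comp fst eta); [apply continuous_fst | apply eta_continuous]. }
  assert (L : locally (x, y) (fun z : R * R => 0 < eta (fst z) - snd z)).
  { apply (Hc (fun r => 0 < r)), (open_gt 0). simpl; lra. }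
  revert L; apply filter_imp; intros z Hz; lra.
Qed.

Lemma fluid_continuous (f : R -> R -> R) (x y : R) :
  continuous_on (fluid_domain eta) (uncurry f) -> y < eta x ->
  continuous (fun z : R * R => f (fst z) (snd z)) (x, y).
Proof.
  intros Hf H.
  exact (continuous_continuous_on _ (uncurry f) _ (fluid_domain_open x y H) Hf).
Qed.

Lemma closed_fluid_continuous (f : R -> R -> R) (x y : R) :
  continuous_on (closed_fluid eta) (uncurry f) -> y < eta x ->
  continuous (fun z : R * R => f (fst z) (snd z)) (x, y).
Proof.
  intros Hf. apply fluid_continuous.
  apply (continuous_on_subset (closed_fluid eta)); [|exact Hf].
  intros z Hz. unfold closed_fluid, fluid_domain in *. lra.
Qed.

(** Fields are continuous only on the closed fluid region, in the relative topology.
Freezing each column above the surface gives a function continuous on the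
whole plane, equal to the field in the fluid. *)
Definition clamp (f : R -> R -> R) (x y : R) : R := f x (Rmin y (eta x)).

Lemma clamp_continuous (f : R -> R -> R) (x y : R) :
  continuous_on (closed_fluid eta) (uncurry f) ->
  continuous (fun z : R * R => clamp f (fst z) (snd z)) (x, y).
Proof.
  intros Hf.
  pose (r := fun z : R * R => (fst z, Rmin (snd z) (eta (fst z)))).
  assert (Hr : forall z, closed_fluid eta (r z)).
  { intros z. apply Rmin_r. }
  assert (Cr : filterlim r (locally (x, y)) (locally (r (x, y)))).
  { assert (E : continuous (fun z : R * R => eta (fst z)) (x, y)).
    { apply (continuous_comp fst eta); [apply continuous_fst | apply eta_continuous]. }
    assert (E2 : continuous (fun z : R * R => Rmin (snd z) (eta (fst z))) (x, y)).
    { apply (continuous_ext (fun z : R * R =>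
        (snd z + eta (fst z) - Rabs (snd z - eta (fst z))) / 2)).
      { intros z. unfold Rmin, Rabs.
        destruct (Rle_dec _ _), (Rcase_abs _); lra. }
      apply continuous_Rdiv.
      - apply continuous_Rminus.
        + apply continuous_Rplus; [apply continuous_snd | exact E].
        + apply (continuous_comp (fun z : R * R => snd z - eta (fst z)) Rabs).
          * apply continuous_Rminus; [apply continuous_snd | exact E].
          * apply continuous_Rabs.
      - apply continuous_const.
      - lra. }
    apply filterlim_locally. intros eps.
    generalize (filter_and _ _
      (proj1 (filterlim_locally _ _) (continuous_fst x y) eps)
      (proj1 (filterlim_locally _ _) E2 eps)).
    apply filter_imp. intros z [Z1 Z2]. split; assumption. }
  intros Q HQ. specialize (Hf (r (x, y)) (Hr _) Q HQ).
  specialize (Cr _ Hf). unfold filtermap in *. unfold within in Cr.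
  revert Cr. apply filter_imp. intros z Hz. exact (Hz (Hr z)).
Qed.

Lemma clamp_fluid (f : R -> R -> R) (x y : R) : y <= eta x -> clamp f x y = f x y.
Proof. intros H. unfold clamp. now rewrite Rmin_left. Qed.

Lemma crest_above_trough : eta (lambda / 2) < eta 0.
Proof. apply (sw_eta_decr _ _ _ _ _ _ _ _ hwave); lra. Qed.

Lemma eta_bounds (x : R) : eta (lambda / 2) <= eta x <= eta 0.
Proof.
  destruct (periodic_representative eta lambda hlambda
    (sw_eta_periodic _ _ _ _ _ _ _ _ hwave) x) as [x' [Hx <-]].
  assert (M : forall t, 0 <= t <= lambda / 2 -> eta (lambda / 2) <= eta t <= eta 0).
  { intros t Ht. assert (D := sw_eta_decr _ _ _ _ _ _ _ _ hwave).
    split.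
    - destruct (Req_dec t (lambda / 2)) as [->|N]; [lra|].
      apply Rlt_le, D; lra.
    - destruct (Req_dec 0 t) as [<-|N]; [lra|].
      apply Rlt_le, D; lra. }
  destruct (Rle_or_lt 0 x') as [H|H].
  - apply M; lra.
  - rewrite <- (sw_eta_even _ _ _ _ _ _ _ _ hwave x'). apply M; lra.
Qed.

Lemma eta_periodic (x : R) : eta (x + lambda) = eta x.
Proof. apply (sw_eta_periodic _ _ _ _ _ _ _ _ hwave). Qed.

Lemma u_lt_c (x y : R) : y <= eta x -> u x y < c.
Proof. apply (sw_no_stagnation _ _ _ _ _ _ _ _ hwave). Qed.

(** Above the surface the stream function is continued with slope [-1], so that every
column is strictly decreasing and onto, and [xi] below is defined and continuous for
all real [p], in particular on a full neighbourhood of the surface value [p = 0]. *)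
Definition psi_ext (x y : R) : R := clamp psi x y + (Rmin y (eta x) - y).

Lemma psi_ext_fluid (x y : R) : y <= eta x -> psi_ext x y = psi x y.
Proof.
  intros H. unfold psi_ext. rewrite clamp_fluid, Rmin_left by exact H. ring.
Qed.

Lemma psi_ext_above (x y : R) : eta x <= y -> psi_ext x y = eta x - y.
Proof.
  intros H. unfold psi_ext, clamp. rewrite Rmin_right by exact H.
  rewrite (sf_surface _ _ _ _ _ hpsi). ring.
Qed.

Lemma psi_ext_continuous (x y : R) :
  continuous (fun z : R * R => psi_ext (fst z) (snd z)) (x, y).
Proof.
  apply continuous_Rplus.
  - apply clamp_continuous, (sf_cont _ _ _ _ _ hpsi).
  - apply continuous_Rminus; [|apply continuous_snd].
    apply (clamp_continuous (fun _ y => y)).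
    apply continuous_on_forall. intros [a b] _. apply continuous_snd.
Qed.

Lemma psi_ext_continuity_pt (x y : R) : continuity_pt (fun s => psi_ext x s) y.
Proof.
  apply continuity_pt_filterlim.
  apply (continuous_pair_curve psi_ext (fun _ => x) (fun s => s)).
  - apply psi_ext_continuous.
  - apply continuous_const.
  - apply continuous_id.
Qed.

Lemma psi_ext_derive_y (x y : R) : y < eta x ->
  is_derive (fun s => psi_ext x s) y (u x y - c).
Proof.
  intros H. apply (is_derive_ext_loc (fun s => psi x s)).
  - assert (L : locally y (fun s => s < eta x)) by (apply (open_lt (eta x)); exact H).
    revert L; apply filter_imp. intros s Hs. symmetry. apply psi_ext_fluid. lra.
  - now apply (sf_y _ _ _ _ _ hpsi).
Qed.

(** The derivative [u - c] is negative below the surface; the surface point itself is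
reached by continuity. *)
Lemma psi_ext_decreasing (x y1 y2 : R) : y1 < y2 -> psi_ext x y2 < psi_ext x y1.
Proof.
  assert (A : forall a b, a < b -> b <= eta x -> psi_ext x b < psi_ext x a).
  { intros a b Hab Hb.
    destruct (MVT_gen (psi_ext x) a b (fun y => u x y - c)) as [y [Hy E]].
    - rewrite Rmin_left, Rmax_right by lra. intros y Hy.
      apply psi_ext_derive_y. lra.
    - intros y _. apply psi_ext_continuity_pt.
    - rewrite Rmin_left, Rmax_right in Hy by lra.
      generalize (u_lt_c x y ltac:(lra)). nra. }
  intros H.
  destruct (Rle_or_lt y2 (eta x)) as [H2|H2]; [now apply A|].
  destruct (Rle_or_lt (eta x) y1) as [H1|H1].
  - rewrite !psi_ext_above by lra. lra.
  - apply Rlt_trans with (psi_ext x (eta x)).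
    + rewrite !psi_ext_above by lra. lra.
    + apply A; lra.
Qed.

(** At great depth [u < c / 2], so [psi] grows at least linearly downwards. *)
Lemma psi_ext_surjective (x p : R) : exists y, psi_ext x y = p.
Proof.
  destruct (Rle_or_lt p 0) as [Hp|Hp].
  { exists (eta x - p). rewrite psi_ext_above by lra. ring. }
  destruct (sw_deep _ _ _ _ _ _ _ _ hwave (c / 2)) as [Y HY]; [lra|].
  (* From [y1] down to [y0], [psi] gains at least [(c / 2) * (2 * p / c) = p]. *)
  pose (y1 := Rmin Y (eta x) - 1). pose (y0 := y1 - 2 * p / c).
  assert (Hy1 : y1 < Y /\ y1 < eta x).
  { unfold y1. generalize (Rmin_l Y (eta x)) (Rmin_r Y (eta x)). lra. }
  assert (Hpc : 0 < 2 * p / c) by (apply Rdiv_lt_0_compat; lra).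
  assert (Hlow : p <= psi_ext x y0).
  { destruct (MVT_gen (psi_ext x) y0 y1 (fun y => u x y - c)) as [y [Hy E]].
    - rewrite Rmin_left, Rmax_right by (unfold y0; lra). intros y Hy.
      apply psi_ext_derive_y. lra.
    - intros y _. apply psi_ext_continuity_pt.
    - rewrite Rmin_left, Rmax_right in Hy by (unfold y0; lra).
      destruct (HY x y) as [Hu _]; [unfold fluid_domain; simpl; lra | lra |].
      apply Rabs_def2 in Hu.
      assert (Ey : y1 - y0 = 2 * p / c) by (unfold y0; ring).
      assert (S : psi_ext x (eta x) < psi_ext x y1) by (apply psi_ext_decreasing; lra).
      rewrite psi_ext_above in S by lra.
      assert (E2 : 2 * p / c * (c / 2) = p) by (field; lra).
      rewrite Ey in E. nra. }
  destruct (IVT_gen (psi_ext x) y0 (eta x) p) as [y [_ Hy]].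
  - intros y. apply psi_ext_continuity_pt.
  - rewrite (psi_ext_above x (eta x)) by lra.
    rewrite Rmin_right, Rmax_left by lra. lra.
  - now exists y.
Qed.

Definition xi (x p : R) : R := iota (fun y : R => psi_ext x y = p).

Lemma psi_ext_injective (x y1 y2 : R) : psi_ext x y1 = psi_ext x y2 -> y1 = y2.
Proof.
  intros E. destruct (Rtotal_order y1 y2) as [H|[H|H]]; [|exact H|];
    apply (psi_ext_decreasing x) in H; lra.
Qed.

Lemma psi_ext_xi (x p : R) : psi_ext x (xi x p) = p.
Proof.
  apply (iota_correct (fun y : R => psi_ext x y = p)).
  destruct (psi_ext_surjective x p) as [y Hy].
  exists y. split; [exact Hy|].
  intros y' Hy'. apply (psi_ext_injective x). congruence.
Qed.

Lemma xi_unique (x y p : R) : psi_ext x y = p -> y = xi x p.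
Proof. intros H. apply (psi_ext_injective x). now rewrite psi_ext_xi. Qed.

Lemma xi_surface (x : R) : xi x 0 = eta x.
Proof. symmetry. apply xi_unique. rewrite psi_ext_above by lra. ring. Qed.

Lemma xi_decreasing (x p1 p2 : R) : p1 < p2 -> xi x p2 < xi x p1.
Proof.
  intros H. destruct (Rlt_or_le (xi x p2) (xi x p1)) as [|L]; [assumption|exfalso].
  assert (psi_ext x (xi x p2) <= psi_ext x (xi x p1)).
  { destruct L as [L| <-]; [apply Rlt_le, psi_ext_decreasing, L | lra]. }
  rewrite !psi_ext_xi in *. lra.
Qed.

Lemma xi_interior (x p : R) : 0 < p -> xi x p < eta x.
Proof. intros H. rewrite <- xi_surface. now apply xi_decreasing. Qed.

Lemma xi_closed (x p : R) : 0 <= p -> xi x p <= eta x.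
Proof. intros [H| <-]; [apply Rlt_le, xi_interior, H | rewrite xi_surface; lra]. Qed.

Lemma psi_xi (x p : R) : 0 <= p -> psi x (xi x p) = p.
Proof. intros H. rewrite <- psi_ext_fluid by now apply xi_closed. apply psi_ext_xi. Qed.

Lemma on_streamline_xi (p x y : R) : on_streamline eta psi p x y -> y = xi x p.
Proof.
  intros [H E]. apply xi_unique. rewrite psi_ext_fluid; [exact E | exact H].
Qed.

Lemma psi_nonneg (x y : R) : y <= eta x -> 0 <= psi x y.
Proof.
  intros H. rewrite <- psi_ext_fluid by exact H.
  replace 0 with (psi_ext x (eta x)) by (rewrite psi_ext_above; lra).
  destruct H as [H| ->]; [apply Rlt_le, psi_ext_decreasing, H | lra].
Qed.

Lemma xi_continuous (x p : R) :
  continuous (fun z : R * R => xi (fst z) (snd z)) (x, p).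
Proof.
  apply (increasing_root_continuous
    (fun (z : R * R) y => snd z - psi_ext (fst z) y)).
  - intros y. apply continuous_Rminus; [apply continuous_snd|].
    apply (continuous_pair_curve psi_ext (fun z : R * R => fst z) (fun _ => y)).
    + apply psi_ext_continuous.
    + apply continuous_fst.
    + apply continuous_const.
  - apply filter_forall. intros z y1 y2 H.
    now apply Rplus_lt_compat_l, Ropp_lt_contravar, psi_ext_decreasing.
  - apply filter_forall. intros z. rewrite psi_ext_xi. ring.
Qed.

(** The difference over a wavelength has zero derivative on each column and vanishes
at the surface. *)
Lemma psi_ext_periodic (x y : R) : psi_ext (x + lambda) y = psi_ext x y.
Proof.
  destruct (Rle_or_lt (eta x) y) as [H|H].
  { rewrite !psi_ext_above by (rewrite ?eta_periodic; exact H).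
    now rewrite eta_periodic. }
  assert (E := zero_derivative_constant
    (fun s => psi_ext (x + lambda) s - psi_ext x s) y (eta x)).
  cbv beta in E.
  rewrite !psi_ext_above in E by (rewrite ?eta_periodic; lra).
  rewrite eta_periodic in E.
  assert (E' : eta x - eta x - (eta x - eta x)
             = psi_ext (x + lambda) y - psi_ext x y); [apply E | lra].
  - lra.
  - intros s Hs. eapply is_derive_value.
    + apply is_derive_Rminus; apply psi_ext_derive_y; rewrite ?eta_periodic; lra.
    + destruct (sw_periodic _ _ _ _ _ _ _ _ hwave x s) as [Eu _];
        [unfold closed_fluid; simpl; lra|].
      rewrite Eu. ring.
  - intros s Hs. apply continuity_pt_minus; apply psi_ext_continuity_pt.
Qed.

Lemma xi_periodic (x p : R) : xi (x + lambda) p = xi x p.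
Proof. symmetry. apply xi_unique. rewrite psi_ext_periodic. apply psi_ext_xi. Qed.

Lemma fluid_section (x y : R) : y < eta x -> locally x (fun s => y < eta s).
Proof.
  intros H. apply (eta_continuous x (fun r => y < r)), (open_gt y), H.
Qed.

Lemma psi_differentiable (x y : R) : y < eta x ->
  differentiable_pt_lim psi x y (- v x y) (u x y - c).
Proof.
  intros H.
  apply (differentiable_of_partials psi (fun x y => - v x y) (fun x y => u x y - c)).
  - apply locally_2d_locally. generalize (fluid_domain_open x y H).
    apply filter_imp. intros [a b] Hab. now apply (sf_x _ _ _ _ _ hpsi).
  - now apply (sf_y _ _ _ _ _ hpsi).
  - apply continuous_Ropp, closed_fluid_continuous, H.
    apply (sw_v_cont _ _ _ _ _ _ _ _ hwave).
Qed.

(** Implicit differentiation for [p > 0].  On the surface [psi] need not be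
differentiable, and the kinematic boundary condition supplies the same formula. *)
Lemma xi_derive (x p : R) : 0 <= p ->
  is_derive (fun s => xi s p) x (v x (xi x p) / (u x (xi x p) - c)).
Proof.
  intros [Hp| <-].
  - assert (Hi := xi_interior x p Hp). assert (Hu := u_lt_c x (xi x p) ltac:(lra)).
    destruct (inverse_map_derive (fun a _ => a) psi (fun s => s) (fun s => xi s p)
      x 1 0 1 0 (- v x (xi x p)) (u x (xi x p) - c)) as [_ H].
    + apply differentiable_pt_lim_fst.
    + apply psi_differentiable, Hi.
    + apply continuous_id.
    + apply (row_continuous xi), xi_continuous.
    + exact (is_derive_Rid x).
    + apply (is_derive_ext (fun _ => p)).
      * intros s. symmetry. apply psi_xi. lra.
      * exact (is_derive_Rconst p x).
    + lra.
    + apply (is_derive_value _ _ _ _ H). field; lra.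
  - rewrite xi_surface.
    apply (is_derive_ext eta); [intros s; now rewrite xi_surface|].
    assert (Hu := u_lt_c x (eta x) ltac:(lra)).
    rewrite (sw_kinematic _ _ _ _ _ _ _ _ hwave).
    replace ((u x (eta x) - c) * Derive eta x / (u x (eta x) - c))
      with (Derive eta x) by (field; lra).
    apply Derive_correct, (sw_eta_diff _ _ _ _ _ _ _ _ hwave).
Qed.

(** * Travel time along a streamline *)

(** The time a particle on the streamline [p] needs per unit of horizontal distance. *)
Definition slowness (x p : R) : R := 1 / (c - clamp u x (xi x p)).

Definition period (p : R) : R :=
  RInt (fun x => slowness x p) (- lambda / 2) (lambda / 2).

Definition elapsed (p x : R) : R := RInt (fun s => slowness s p) 0 x.

Lemma clamp_u_lt_c (x y : R) : clamp u x y < c.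
Proof. apply u_lt_c, Rmin_r. Qed.

Lemma slowness_pos (x p : R) : 0 < slowness x p.
Proof.
  apply Rdiv_lt_0_compat; [lra|]. generalize (clamp_u_lt_c x (xi x p)); lra.
Qed.

Lemma slowness_fluid (x p : R) : 0 <= p ->
  slowness x p = 1 / (c - u x (xi x p)).
Proof. intros H. unfold slowness. now rewrite clamp_fluid by now apply xi_closed. Qed.

Lemma slowness_continuous (x p : R) :
  continuous (fun z : R * R => slowness (fst z) (snd z)) (x, p).
Proof.
  unfold slowness. apply continuous_Rdiv.
  - apply continuous_const.
  - apply continuous_Rminus; [apply continuous_const|].
    apply (continuous_pair_curve (clamp u) (fun z : R * R => fst z)
             (fun z : R * R => xi (fst z) (snd z))).
    + apply clamp_continuous, (sw_u_cont _ _ _ _ _ _ _ _ hwave).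
    + apply continuous_fst.
    + apply xi_continuous.
  - generalize (clamp_u_lt_c x (xi x p)). simpl; lra.
Qed.

Lemma slowness_row_continuous (p x : R) : continuous (fun s => slowness s p) x.
Proof. apply row_continuous, slowness_continuous. Qed.

Lemma slowness_periodic (x p : R) : slowness (x + lambda) p = slowness x p.
Proof.
  unfold slowness, clamp. rewrite xi_periodic, eta_periodic.
  destruct (sw_periodic _ _ _ _ _ _ _ _ hwave x (Rmin (xi x p) (eta x)))
    as [-> _]; [apply Rmin_r | reflexivity].
Qed.

Lemma slowness_integrable (p a b : R) : ex_RInt (fun x => slowness x p) a b.
Proof.
  apply (ex_RInt_continuous (V := R_CompleteNormedModule)).
  intros x _. apply slowness_row_continuous.
Qed.

Lemma elapsed_derive (p x : R) : is_derive (elapsed p) x (slowness x p).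
Proof.
  apply (is_derive_RInt (V := R_NormedModule) (fun s => slowness s p) (elapsed p) 0).
  - apply filter_forall. intros y.
    apply (RInt_correct (V := R_CompleteNormedModule)), slowness_integrable.
  - apply slowness_row_continuous.
Qed.

Lemma elapsed_increasing (p x1 x2 : R) : x1 < x2 -> elapsed p x1 < elapsed p x2.
Proof.
  intros H.
  destruct (MVT_gen (elapsed p) x1 x2 (fun x => slowness x p)) as [x [_ E]].
  - intros x _. apply elapsed_derive.
  - intros x _. apply (is_derive_continuity_pt _ _ _ (elapsed_derive p x)).
  - generalize (slowness_pos x p). nra.
Qed.

Lemma elapsed_injective (p x1 x2 : R) : elapsed p x1 = elapsed p x2 -> x1 = x2.
Proof.
  intros E. destruct (Rtotal_order x1 x2) as [H|[H|H]]; [|exact H|];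
    apply (elapsed_increasing p) in H; lra.
Qed.

(** The gain over a wavelength has zero derivative; it is computed at
[- lambda / 2]. *)
Lemma elapsed_over_period (p x : R) :
  elapsed p (x + lambda) = elapsed p x + period p.
Proof.
  pose (D := fun x => elapsed p (x + lambda) - elapsed p x).
  assert (HD : forall x, is_derive D x 0).
  { intros y. eapply is_derive_value.
    - apply is_derive_Rminus; [apply is_derive_shift|]; apply elapsed_derive.
    - rewrite slowness_periodic. ring. }
  assert (K : forall a b, a <= b -> D b = D a).
  { intros a b Hab. apply zero_derivative_constant; [exact Hab | intros; apply HD |].
    intros y _. apply (is_derive_continuity_pt _ _ _ (HD y)). }
  assert (E : D x = D (- lambda / 2)).
  { destruct (Rle_or_lt x (- lambda / 2)) as [H|H];
      [symmetry|]; apply K; lra. }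
  assert (Ep : D (- lambda / 2) = period p).
  { unfold D, elapsed, period.
    rewrite <- (RInt_Chasles (V := R_CompleteNormedModule) _ 0 (- lambda / 2)
                  (- lambda / 2 + lambda)) by apply slowness_integrable.
    replace (- lambda / 2 + lambda) with (lambda / 2) by field.
    unfold plus; simpl. ring. }
  unfold D in E, Ep. lra.
Qed.

Lemma period_pos (p : R) : 0 < period p.
Proof.
  apply RInt_gt_0; [lra | intros; apply slowness_pos |].
  intros x _. apply slowness_row_continuous.
Qed.

Lemma period_continuous (p : R) : continuous period p.
Proof.
  apply (RInt_param_continuous slowness); [lra | apply slowness_continuous].
Qed.

Lemma elapsed_surjective (p r : R) : exists x, elapsed p x = r.
Proof.
  apply (quasi_periodic_surjective (elapsed p) lambda (period p)).
  - intros x. apply (is_derive_continuity_pt _ _ _ (elapsed_derive p x)).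
  - apply period_pos.
  - apply elapsed_over_period.
Qed.

(** * Particle paths *)

Section Path.

Variables X Y : R -> R.
Hypothesis hpath : particle_path c eta u v X Y.

Lemma path_closed (t : R) : Y t <= eta (X t - c * t).
Proof. exact (pp_fluid _ _ _ _ _ _ hpath t). Qed.

Lemma path_x_derive (t : R) :
  is_derive (fun t => X t - c * t) t (u (X t - c * t) (Y t) - c).
Proof.
  apply is_derive_Rminus; [apply (pp_x _ _ _ _ _ _ hpath)|].
  auto_derive; [exact I | ring].
Qed.

Lemma path_psi_derive (t : R) : 0 < psi (X t - c * t) (Y t) ->
  is_derive (fun t => psi (X t - c * t) (Y t)) t 0.
Proof.
  intros H.
  assert (Hin : Y t < eta (X t - c * t)).
  { destruct (path_closed t) as [L|E]; [exact L|].
    rewrite E, (sf_surface _ _ _ _ _ hpsi) in H. lra. }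
  apply (is_derive_value _ _ (- v (X t - c * t) (Y t) * (u (X t - c * t) (Y t) - c)
           + (u (X t - c * t) (Y t) - c) * v (X t - c * t) (Y t))); [|ring].
  apply is_derive_Reals.
  apply (derivable_pt_lim_comp_2d psi (fun t => X t - c * t) Y).
  - now apply psi_differentiable.
  - apply is_derive_Reals, path_x_derive.
  - apply is_derive_Reals, (pp_y _ _ _ _ _ _ hpath).
Qed.

Lemma path_psi_continuous (t : R) :
  continuous (fun t => psi (X t - c * t) (Y t)) t.
Proof.
  apply (continuous_ext (fun t => psi_ext (X t - c * t) (Y t))).
  { intros s. apply psi_ext_fluid, path_closed. }
  apply (continuous_pair_curve psi_ext (fun t => X t - c * t) Y).
  - apply psi_ext_continuous.
  - apply (ex_derive_continuous (V := R_NormedModule)).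
    eexists; apply path_x_derive.
  - apply (ex_derive_continuous (V := R_NormedModule)).
    eexists; apply (pp_y _ _ _ _ _ _ hpath).
Qed.

(** Where the path may touch the surface, the chain rule is not available.  Truncating
[psi] below at [e > 0] removes these instants: near them the truncation is constant,
and elsewhere it inherits the zero derivative of [psi] because the truncation is
1-Lipschitz. *)
Lemma path_psi_max_derive (e t : R) : 0 < e ->
  is_derive (fun t => Rmax (psi (X t - c * t) (Y t)) e) t 0.
Proof.
  intros He. pose (h := fun t => psi (X t - c * t) (Y t)).
  change (is_derive (fun t => Rmax (h t) e) t 0).
  destruct (Rlt_or_le (h t) e) as [H|H].
  - apply (is_derive_ext_loc (fun _ => e)).
    + assert (L : locally t (fun s => h s < e)).
      { apply (path_psi_continuous t (fun r => r < e)), (open_lt e), H. }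
      revert L; apply filter_imp. intros s Hs. now rewrite Rmax_right by lra.
    + exact (is_derive_Rconst e t).
  - apply is_derive_eps. intros d.
    assert (L := proj1 (is_derive_eps h t 0) (path_psi_derive t ltac:(unfold h in H; lra)) d).
    revert L. apply filter_imp. intros s Hs.
    eapply Rle_trans; [|exact Hs].
    rewrite !Rmult_0_l, !Rminus_0_r.
    unfold Rmax, Rabs. repeat destruct (Rle_dec _ _); repeat destruct (Rcase_abs _); lra.
Qed.

Lemma path_psi_constant (t1 t2 : R) :
  psi (X t1 - c * t1) (Y t1) = psi (X t2 - c * t2) (Y t2).
Proof.
  pose (h := fun t => psi (X t - c * t) (Y t)). change (h t1 = h t2).
  assert (M : forall e a b, 0 < e -> a <= b -> Rmax (h b) e = Rmax (h a) e).
  { intros e a b He Hab.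
    apply (zero_derivative_constant (fun t => Rmax (h t) e)); [exact Hab| |].
    - intros t _. now apply path_psi_max_derive.
    - intros t _. apply (is_derive_continuity_pt _ t 0). now apply path_psi_max_derive. }
  assert (M' : forall e, 0 < e -> Rmax (h t1) e = Rmax (h t2) e).
  { intros e He. destruct (Rle_or_lt t1 t2); [symmetry|]; apply M; lra. }
  assert (P1 : 0 <= h t1) by apply psi_nonneg, path_closed.
  assert (P2 : 0 <= h t2) by apply psi_nonneg, path_closed.
  destruct (Req_dec (h t1) (h t2)) as [|N]; [assumption|exfalso].
  assert (E := M' ((h t1 + h t2) / 2) ltac:(lra)).
  unfold Rmax in E. repeat destruct (Rle_dec _ _); lra.
Qed.

Lemma path_on_xi (p : R) : lies_on c eta psi p X Y ->
  forall t, Y t = xi (X t - c * t) p.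
Proof.
  intros [t1 [_ H1]] t. apply on_streamline_xi. split; [apply path_closed|].
  rewrite (path_psi_constant t t1). exact H1.
Qed.

Lemma lies_on_nonneg (p : R) : lies_on c eta psi p X Y -> 0 <= p.
Proof. intros [t1 [H1 <-]]. apply psi_nonneg, H1. Qed.

(** Along a path the horizontal velocity is minus the reciprocal of the slowness. *)
Lemma path_elapsed (p : R) : lies_on c eta psi p X Y ->
  forall t1 t2, elapsed p (X t2 - c * t2) = elapsed p (X t1 - c * t1) - (t2 - t1).
Proof.
  intros Hon t1 t2.
  assert (HD : forall t, is_derive (fun t => elapsed p (X t - c * t) + t) t 0).
  { intros t. eapply is_derive_value.
    - apply is_derive_Rplus.
      + apply (is_derive_comp (elapsed p) (fun t => X t - c * t)).
        * apply elapsed_derive.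
        * apply path_x_derive.
      + exact (is_derive_Rid t).
    - rewrite slowness_fluid by now apply lies_on_nonneg.
      rewrite <- path_on_xi by exact Hon.
      unfold scal; simpl; unfold mult; simpl.
      generalize (u_lt_c _ _ (path_closed t)). intros. field. lra. }
  assert (K : forall a b, a <= b ->
    elapsed p (X b - c * b) + b = elapsed p (X a - c * a) + a).
  { intros a b Hab. apply (zero_derivative_constant (fun t => elapsed p (X t - c * t) + t));
      [exact Hab | intros; apply HD |].
    intros y _. apply (is_derive_continuity_pt _ _ _ (HD y)). }
  destruct (Rle_or_lt t1 t2) as [H|H]; [assert (E := K t1 t2 H) |
    assert (E := K t2 t1 ltac:(lra))]; lra.
Qed.

Lemma path_period (p t0 : R) : lies_on c eta psi p X Y ->
  X (period p + t0) - c * period p = X t0 - lambda.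
Proof.
  intros Hon.
  assert (E : X (period p + t0) - c * (period p + t0) = X t0 - c * t0 - lambda); [|lra].
  apply (elapsed_injective p).
  rewrite (path_elapsed p Hon t0 (period p + t0)).
  assert (E := elapsed_over_period p (X t0 - c * t0 - lambda)).
  replace (X t0 - c * t0 - lambda + lambda) with (X t0 - c * t0) in E by ring.
  lra.
Qed.

End Path.

(** The inverse of the travel time gives the horizontal motion, and the streamline
height the vertical one.  Existence matters because the time period is characterized
through the paths on the streamline. *)
Lemma streamline_path_exists (p : R) : 0 <= p ->
  exists X Y, particle_path c eta u v X Y /\ lies_on c eta psi p X Y.
Proof.
  intros Hp.
  (* Time runs against [x] because particles move left in the moving frame. *)
  pose (rho := fun t : R => iota (fun x : R => elapsed p x = - t)).
  assert (Hrho : forall t, elapsed p (rho t) = - t).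
  { intros t. apply (iota_correct (fun x : R => elapsed p x = - t)).
    destruct (elapsed_surjective p (- t)) as [x Hx].
    exists x. split; [exact Hx|]. intros x' Hx'. apply (elapsed_injective p). congruence. }
  assert (Crho : forall t, continuous rho t).
  { intros t. apply (increasing_root_continuous (fun s x => elapsed p x + s)).
    - intros y. apply continuous_Rplus; [apply continuous_const | apply continuous_id].
    - apply filter_forall. intros s x1 x2 H.
      apply Rplus_lt_compat_r, elapsed_increasing, H.
    - apply filter_forall. intros s. rewrite Hrho. ring. }
  assert (Drho : forall t, is_derive rho t (u (rho t) (xi (rho t) p) - c)).
  { intros t. assert (U := u_lt_c _ _ (xi_closed (rho t) p Hp)).
    destruct (inverse_map_derive (fun x _ => elapsed p x) (fun _ y => y) rho (fun s => s)
      t (-1) 1 (slowness (rho t) p) 0 0 1) as [H _].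
    - apply (differentiable_pt_lim_proj1_0 (elapsed p)), is_derive_Reals, elapsed_derive.
    - apply differentiable_pt_lim_snd.
    - apply Crho.
    - apply continuous_id.
    - apply (is_derive_ext (fun s => - s)); [intros s; now rewrite Hrho|].
      auto_derive; [exact I | ring].
    - exact (is_derive_Rid t).
    - generalize (slowness_pos (rho t) p). lra.
    - apply (is_derive_value _ _ _ _ H).
      rewrite slowness_fluid by exact Hp. field. lra. }
  exists (fun t => rho t + c * t), (fun t => xi (rho t) p).
  assert (E : forall t, rho t + c * t - c * t = rho t) by (intros; ring).
  split.
  - split; intros t; rewrite E.
    + unfold closed_fluid; simpl. now apply xi_closed.
    + eapply is_derive_value.
      * apply is_derive_Rplus; [apply Drho|].
        instantiate (1 := c). auto_derive; [exact I | ring].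
      * ring.
    + assert (U := u_lt_c _ _ (xi_closed (rho t) p Hp)).
      eapply is_derive_value.
      * apply (is_derive_comp (fun x => xi x p) rho);
          [apply xi_derive, Hp | apply Drho].
      * unfold scal; simpl; unfold mult; simpl. field. lra.
  - exists 0. rewrite E. split.
    + unfold closed_fluid; simpl. now apply xi_closed.
    + now apply psi_xi.
Qed.

(** Uniqueness is tested on one path: a time after which it has advanced by exactly one
wavelength must be the period, since [elapsed] is injective. *)
Lemma time_period_eq (p : R) : 0 <= p ->
  time_period c lambda eta u v psi p = period p.
Proof.
  intros Hp.
  assert (Hex : is_time_period c lambda eta u v psi p (period p)).
  { split; [apply period_pos|]. intros X Y t0 HXY Hon. now apply (path_period X Y). }
  assert (Huniq : forall T, is_time_period c lambda eta u v psi p T -> period p = T).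
  { intros T [_ HT]. destruct (streamline_path_exists p Hp) as [X [Y [HXY Hon]]].
    assert (E1 := HT X Y 0 HXY Hon). assert (E2 := path_period X Y HXY p 0 Hon).
    assert (F1 := path_elapsed X Y HXY p Hon 0 (T + 0)).
    assert (F2 := path_elapsed X Y HXY p Hon 0 (period p + 0)).
    replace (X (T + 0) - c * (T + 0)) with (X 0 - lambda) in F1 by lra.
    replace (X (period p + 0) - c * (period p + 0)) with (X 0 - lambda) in F2 by lra.
    lra. }
  symmetry. apply Huniq. unfold time_period.
  apply (iota_correct (is_time_period c lambda eta u v psi p)).
  exists (period p). split; [exact Hex | exact Huniq].
Qed.

(** * Velocity potential and hodograph coordinates *)

(** Any level below the trough would do: the whole line [y = base_level] is in the fluid,
so the potential can be built from it along columns. *)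
Definition base_level : R := eta (lambda / 2) - 1.

Lemma base_level_fluid (x : R) : base_level < eta x.
Proof. unfold base_level. generalize (eta_bounds x). lra. Qed.

(** A potential of the field [(c - u, - v)]; the sign makes it increase with [x]. *)
Definition potential (x y : R) : R :=
  RInt (fun s => c - u s base_level) 0 x - RInt (fun s => v x s) base_level y.

Lemma u_fluid_continuous (x y : R) : y < eta x ->
  continuous (fun z : R * R => u (fst z) (snd z)) (x, y).
Proof. apply closed_fluid_continuous, (sw_u_cont _ _ _ _ _ _ _ _ hwave). Qed.

Lemma v_fluid_continuous (x y : R) : y < eta x ->
  continuous (fun z : R * R => v (fst z) (snd z)) (x, y).
Proof. apply closed_fluid_continuous, (sw_v_cont _ _ _ _ _ _ _ _ hwave). Qed.

Lemma column_fluid (x y t : R) : y < eta x ->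
  Rmin base_level y <= t <= Rmax base_level y -> t < eta x.
Proof.
  intros H [_ Ht]. apply Rle_lt_trans with (1 := Ht).
  apply Rmax_lub_lt; [apply base_level_fluid | exact H].
Qed.

Lemma v_column_integrable (x y : R) : y < eta x ->
  ex_RInt (fun s => v x s) base_level y.
Proof.
  intros H. apply (ex_RInt_continuous (V := R_CompleteNormedModule)).
  intros t Ht. apply column_continuous, v_fluid_continuous.
  now apply (column_fluid x y).
Qed.

Lemma potential_derive_y (x y : R) : y < eta x ->
  is_derive (fun s => potential x s) y (- v x y).
Proof.
  intros H. apply (is_derive_value _ _ (0 - v x y)); [|ring].
  apply is_derive_Rminus.
  - apply is_derive_Rconst.
  - apply (is_derive_RInt (V := R_NormedModule) (fun s => v x s)
             (fun y => RInt (fun s => v x s) base_level y) base_level).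
    + assert (L : locally y (fun s => s < eta x)) by (apply (open_lt (eta x)), H).
      revert L; apply filter_imp. intros s Hs.
      apply (RInt_correct (V := R_CompleteNormedModule)), v_column_integrable, Hs.
    + apply column_continuous, v_fluid_continuous, H.
Qed.

(** Differentiation under the integral sign; irrotationality turns the integrand
[v_x] into [u_y], which integrates exactly. *)
Lemma v_column_derive (x y : R) : y < eta x ->
  is_derive (fun x => RInt (fun s => v x s) base_level y) x
    (u x y - u x base_level).
Proof.
  intros H.
  assert (Hu := sw_u_C1 _ _ _ _ _ _ _ _ hwave).
  assert (Hv := sw_v_C1 _ _ _ _ _ _ _ _ hwave).
  assert (E : RInt (fun t => Derive (fun s => v s t) x) base_level y
              = u x y - u x base_level).
  { apply is_RInt_unique.
    apply (is_RInt_ext (fun t => partial_y u x t)).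
    { intros t Ht. assert (Hin : t < eta x) by (apply (column_fluid x y); [exact H | lra]).
      generalize (sw_irrotational _ _ _ _ _ _ _ _ hwave x t Hin).
      unfold partial_x. lra. }
    apply (is_RInt_derive (fun t => u x t)).
    - intros t Ht. apply Derive_correct.
      apply (C1_ex_y _ _ Hu), (column_fluid x y); assumption.
    - intros t Ht. apply column_continuous.
      apply (fluid_continuous (partial_y u)); [exact (C1_cont_y _ _ Hu)|].
      apply (column_fluid x y); assumption. }
  rewrite <- E.
  apply (is_derive_RInt_param v base_level y x).
  - generalize (fluid_section x y H). apply filter_imp. intros s Hs t Ht.
    apply (C1_ex_x _ _ Hv), (column_fluid s y); assumption.
  - intros t Ht. apply continuity_2d_pt_filterlim.
    apply (fluid_continuous (partial_x v)); [exact (C1_cont_x _ _ Hv)|].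
    apply (column_fluid x y); assumption.
  - generalize (fluid_section x y H). apply filter_imp. intros s Hs.
    now apply v_column_integrable.
Qed.

Lemma potential_derive_x (x y : R) : y < eta x ->
  is_derive (fun s => potential s y) x (c - u x y).
Proof.
  intros H.
  apply (is_derive_value _ _ ((c - u x base_level) - (u x y - u x base_level))); [|ring].
  apply is_derive_Rminus; [|now apply v_column_derive].
  assert (C : forall s, continuous (fun s => c - u s base_level) s).
  { intros s. apply continuous_Rminus; [apply continuous_const|].
    apply (row_continuous u), u_fluid_continuous, base_level_fluid. }
  apply (is_derive_RInt (V := R_NormedModule) (fun s => c - u s base_level)
             (fun x => RInt (fun s => c - u s base_level) 0 x) 0).
  - apply filter_forall. intros s.
    apply (RInt_correct (V := R_CompleteNormedModule)).
    apply (ex_RInt_continuous (V := R_CompleteNormedModule)). intros; apply C.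
  - apply C.
Qed.

Lemma potential_differentiable (x y : R) : y < eta x ->
  differentiable_pt_lim potential x y (c - u x y) (- v x y).
Proof.
  intros H.
  apply (differentiable_of_partials potential (fun x y => c - u x y) (fun x y => - v x y)).
  - apply locally_2d_locally. generalize (fluid_domain_open x y H).
    apply filter_imp. intros [a b] Hab. now apply potential_derive_x.
  - now apply potential_derive_y.
  - apply continuous_Rminus; [apply continuous_const | now apply u_fluid_continuous].
Qed.

(** The gain over a wavelength does not depend on the depth, because [v] is periodic.  By
the mean value theorem it is [lambda * (c - u)] at some point of any chosen depth,
and [u] tends to 0 with depth. *)
Lemma potential_over_period (x y : R) : y < eta x ->
  potential (x + lambda) y = potential x y + c * lambda.
Proof.
  intros H. pose (D := fun y => potential (x + lambda) y - potential x y).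
  assert (HD : forall t, t < eta x -> is_derive D t 0).
  { intros t Ht. eapply is_derive_value.
    - apply is_derive_Rminus; apply potential_derive_y; rewrite ?eta_periodic; exact Ht.
    - destruct (sw_periodic _ _ _ _ _ _ _ _ hwave x t) as [_ [-> _]];
        [unfold closed_fluid; simpl; lra | ring]. }
  assert (Hsmall : forall e, 0 < e -> Rabs (D y - c * lambda) <= lambda * e).
  { intros e He. destruct (sw_deep _ _ _ _ _ _ _ _ hwave e He) as [Y HY].
    pose (y' := Rmin y (Rmin Y base_level) - 1).
    assert (Hy' : y' < y /\ y' < Y /\ y' < base_level).
    { unfold y'. generalize (Rmin_l y (Rmin Y base_level)) (Rmin_r y (Rmin Y base_level))
        (Rmin_l Y base_level) (Rmin_r Y base_level). lra. }
    assert (Hin : forall s, y' < eta s)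
      by (intros s; generalize (base_level_fluid s); lra).
    assert (E : D y = D y').
    { apply zero_derivative_constant; [lra | intros t Ht; apply HD; lra |].
      intros t Ht. apply (is_derive_continuity_pt _ _ 0), HD. lra. }
    destruct (MVT_gen (fun s => potential s y') x (x + lambda) (fun s => c - u s y'))
      as [s [_ Hs]].
    - intros s _. now apply potential_derive_x.
    - intros s _. apply (is_derive_continuity_pt _ _ (c - u s y')).
      now apply potential_derive_x.
    - rewrite E. unfold D.
      replace (potential (x + lambda) y' - potential x y' - c * lambda)
        with (- (lambda * u s y')) by lra.
      rewrite Rabs_Ropp, Rabs_mult, (Rabs_pos_eq lambda) by lra.
      apply Rmult_le_compat_l; [lra|].
      apply Rlt_le, HY; [apply Hin | apply Hy']. }
  assert (Z : D y - c * lambda = 0); [|unfold D in Z; lra].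
  destruct (Req_dec (D y - c * lambda) 0) as [|N]; [assumption|exfalso].
  apply Rabs_pos_lt in N.
  assert (He : 0 < Rabs (D y - c * lambda) / (2 * lambda))
    by (apply Rdiv_lt_0_compat; lra).
  apply Hsmall in He.
  replace (lambda * (Rabs (D y - c * lambda) / (2 * lambda)))
    with (Rabs (D y - c * lambda) / 2) in He by (field; lra).
  lra.
Qed.

Definition Phi (p x : R) : R := potential x (xi x p).

Definition speed_sq (x y : R) : R := (c - u x y) ^ 2 + v x y ^ 2.

Lemma speed_sq_pos (x y : R) : y <= eta x -> 0 < speed_sq x y.
Proof.
  intros H. unfold speed_sq. apply u_lt_c in H.
  assert (0 < (c - u x y) ^ 2) by (apply pow_lt; lra).
  generalize (pow2_ge_0 (v x y)). lra.
Qed.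

Lemma Phi_derive (p x : R) : 0 < p ->
  is_derive (Phi p) x (speed_sq x (xi x p) / (c - u x (xi x p))).
Proof.
  intros Hp. assert (Hi := xi_interior x p Hp). assert (U := u_lt_c x (xi x p) ltac:(lra)).
  eapply is_derive_value.
  - apply is_derive_Reals.
    apply (derivable_pt_lim_comp_2d potential (fun x => x) (fun x => xi x p)).
    + apply potential_differentiable, Hi.
    + apply is_derive_Reals. exact (is_derive_Rid x).
    + apply is_derive_Reals, xi_derive. lra.
  - unfold speed_sq. field. lra.
Qed.

Lemma Phi_increasing (p x1 x2 : R) : 0 < p -> x1 < x2 -> Phi p x1 < Phi p x2.
Proof.
  intros Hp H.
  destruct (MVT_gen (Phi p) x1 x2 (fun x => speed_sq x (xi x p) / (c - u x (xi x p))))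
    as [x [_ E]].
  - intros x _. now apply Phi_derive.
  - intros x _. apply (is_derive_continuity_pt _ _ _ (Phi_derive p x Hp)).
  - assert (0 < speed_sq x (xi x p) / (c - u x (xi x p))); [|nra].
    assert (Hc := xi_closed x p ltac:(lra)).
    apply Rdiv_lt_0_compat; [now apply speed_sq_pos | generalize (u_lt_c _ _ Hc); lra].
Qed.

Lemma Phi_injective (p x1 x2 : R) : 0 < p -> Phi p x1 = Phi p x2 -> x1 = x2.
Proof.
  intros Hp E. destruct (Rtotal_order x1 x2) as [H|[H|H]]; [|exact H|];
    apply (Phi_increasing p _ _ Hp) in H; lra.
Qed.

Lemma Phi_over_period (p x : R) : 0 < p -> Phi p (x + lambda) = Phi p x + c * lambda.
Proof.
  intros Hp. unfold Phi. rewrite xi_periodic. now apply potential_over_period, xi_interior.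
Qed.

(** Together with [hodo_y], the inverse of the map from the fluid point [(x, y)] to
its potential [q] and stream value [p]. *)
Definition hodo_x (q p : R) : R := iota (fun x : R => Phi p x = q).

Definition hodo_y (q p : R) : R := xi (hodo_x q p) p.

Lemma Phi_hodo_x (q p : R) : 0 < p -> Phi p (hodo_x q p) = q.
Proof.
  intros Hp. apply (iota_correct (fun x : R => Phi p x = q)).
  destruct (quasi_periodic_surjective (Phi p) lambda (c * lambda)) with q as [x Hx].
  - intros x. apply (is_derive_continuity_pt _ _ _ (Phi_derive p x Hp)).
  - now apply Rmult_lt_0_compat.
  - intros x. now apply Phi_over_period.
  - exists x. split; [exact Hx|]. intros x' Hx'. apply (Phi_injective p); [exact Hp|].
    congruence.
Qed.

Lemma hodo_x_Phi (p x : R) : 0 < p -> hodo_x (Phi p x) p = x.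
Proof. intros Hp. apply (Phi_injective p); [exact Hp | now apply Phi_hodo_x]. Qed.

Lemma hodo_x_over_period (q p : R) : 0 < p -> hodo_x (q + c * lambda) p = hodo_x q p + lambda.
Proof.
  intros Hp. apply (Phi_injective p); [exact Hp|].
  rewrite Phi_over_period, !Phi_hodo_x by exact Hp. reflexivity.
Qed.

Lemma hodo_y_interior (q p : R) : 0 < p -> hodo_y q p < eta (hodo_x q p).
Proof. apply xi_interior. Qed.

Lemma locally_pos (q p : R) : 0 < p -> locally (q, p) (fun z : R * R => 0 < snd z).
Proof. intros Hp. apply (continuous_snd q p (fun r => 0 < r)), (open_gt 0), Hp. Qed.

Lemma hodo_x_continuous (q p : R) : 0 < p ->
  continuous (fun z : R * R => hodo_x (fst z) (snd z)) (q, p).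
Proof.
  intros Hp.
  apply (increasing_root_continuous
    (fun (z : R * R) x => Phi (snd z) x - fst z)).
  - intros x. apply continuous_Rminus; [|apply continuous_fst].
    apply (continuous_comp (fun z : R * R => xi x (snd z)) (fun y => potential x y)).
    + apply (continuous_comp (fun z : R * R => snd z) (fun p => xi x p)).
      * apply continuous_snd.
      * apply column_continuous, xi_continuous.
    + apply (ex_derive_continuous (V := R_NormedModule)).
      eexists. now apply potential_derive_y, xi_interior.
  - generalize (locally_pos q p Hp). apply filter_imp. intros z Hz x1 x2 H.
    apply Rplus_lt_compat_r, Phi_increasing; assumption.
  - generalize (locally_pos q p Hp). apply filter_imp. intros z Hz.
    rewrite Phi_hodo_x by exact Hz. ring.
Qed.

Lemma hodo_y_continuous (q p : R) : 0 < p ->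
  continuous (fun z : R * R => hodo_y (fst z) (snd z)) (q, p).
Proof.
  intros Hp. apply (continuous_pair_curve xi (fun z : R * R => hodo_x (fst z) (snd z)) snd).
  - apply xi_continuous.
  - now apply hodo_x_continuous.
  - apply continuous_snd.
Qed.

(** * Reciprocal of the complex velocity *)

(** [recip_re + i recip_im] is [1 / (U + i v)] with [U = c - u]. *)
Definition recip_re (x y : R) : R := (c - u x y) / speed_sq x y.
Definition recip_im (x y : R) : R := - v x y / speed_sq x y.

(** The Jacobian matrix of (potential, stream function) has determinant
[- speed_sq], so its inverse has the entries of [1 / (U + i v)]. *)
Lemma hodograph_curve_derive (x y : R -> R) (s k1 k2 : R) :
  y s < eta (x s) -> continuous x s -> continuous y s ->
  is_derive (fun s => potential (x s) (y s)) s k1 ->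
  is_derive (fun s => psi (x s) (y s)) s k2 ->
  is_derive x s (k1 * recip_re (x s) (y s) + k2 * recip_im (x s) (y s)) /\
  is_derive y s (k1 * recip_im (x s) (y s) - k2 * recip_re (x s) (y s)).
Proof.
  intros Hin Cx Cy D1 D2.
  assert (S := speed_sq_pos (x s) (y s) ltac:(lra)). unfold speed_sq in S.
  destruct (inverse_map_derive potential psi x y s k1 k2 _ _ _ _
    (potential_differentiable _ _ Hin) (psi_differentiable _ _ Hin) Cx Cy D1 D2) as [E1 E2].
  - nra.
  - split; eapply is_derive_value;
      [exact E1 | | exact E2 |]; unfold recip_re, recip_im, speed_sq; field; split; nra.
Qed.

Lemma hodograph_derive_q (q p : R) : 0 < p ->
  is_derive (fun s => hodo_x s p) q (recip_re (hodo_x q p) (hodo_y q p)) /\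
  is_derive (fun s => hodo_y s p) q (recip_im (hodo_x q p) (hodo_y q p)).
Proof.
  intros Hp.
  destruct (hodograph_curve_derive (fun s => hodo_x s p) (fun s => hodo_y s p) q 1 0) as [E1 E2].
  - now apply hodo_y_interior.
  - apply (row_continuous hodo_x), hodo_x_continuous, Hp.
  - apply (row_continuous hodo_y), hodo_y_continuous, Hp.
  - apply (is_derive_ext (fun s => s)); [intros s; symmetry; apply (Phi_hodo_x s p Hp)|].
    exact (is_derive_Rid q).
  - apply (is_derive_ext (fun _ => p)); [intros s; symmetry; apply psi_xi; lra|].
    exact (is_derive_Rconst p q).
  - split; eapply is_derive_value; [exact E1 | ring | exact E2 | ring].
Qed.

Lemma hodograph_derive_p (q p : R) : 0 < p ->
  is_derive (fun s => hodo_x q s) p (recip_im (hodo_x q p) (hodo_y q p)) /\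
  is_derive (fun s => hodo_y q s) p (- recip_re (hodo_x q p) (hodo_y q p)).
Proof.
  intros Hp.
  assert (L : locally p (fun s => 0 < s)) by (apply (open_gt 0), Hp).
  destruct (hodograph_curve_derive (fun s => hodo_x q s) (fun s => hodo_y q s) p 0 1) as [E1 E2].
  - now apply hodo_y_interior.
  - apply (column_continuous hodo_x), hodo_x_continuous, Hp.
  - apply (column_continuous hodo_y), hodo_y_continuous, Hp.
  - apply (is_derive_ext_loc (fun _ => q)).
    + revert L; apply filter_imp. intros s Hs. symmetry. apply (Phi_hodo_x q s Hs).
    + exact (is_derive_Rconst q p).
  - apply (is_derive_ext_loc (fun s => s)).
    + revert L; apply filter_imp. intros s Hs. symmetry. apply psi_xi. lra.
    + exact (is_derive_Rid p).
  - split; eapply is_derive_value; [exact E1 | ring | exact E2 | ring].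
Qed.

(** [recip_re_x + i recip_im_x] is the complex derivative of
[recip_re + i recip_im] with respect to [x + i y], written with the [x]-derivatives
of the velocity only. *)
Definition recip_re_x (x y : R) : R :=
  partial_x u x y * (recip_re x y ^ 2 - recip_im x y ^ 2)
  + partial_x v x y * (2 * recip_re x y * recip_im x y).

Definition recip_im_x (x y : R) : R :=
  partial_x u x y * (2 * recip_re x y * recip_im x y)
  - partial_x v x y * (recip_re x y ^ 2 - recip_im x y ^ 2).

Lemma recip_derive_x (x y : R) : y < eta x ->
  is_derive (fun s => recip_re s y) x (recip_re_x x y) /\
  is_derive (fun s => recip_im s y) x (recip_im_x x y).
Proof.
  intros H.
  apply (inverse_velocity_derive c (fun s => u s y) (fun s => v s y) x).
  - apply Derive_correct, (C1_ex_x _ _ (sw_u_C1 _ _ _ _ _ _ _ _ hwave)), H.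
  - apply Derive_correct, (C1_ex_x _ _ (sw_v_C1 _ _ _ _ _ _ _ _ hwave)), H.
  - apply speed_sq_pos; lra.
Qed.

(** Incompressibility and irrotationality are the Cauchy-Riemann equations of
[U + i v]; they trade the [y]-derivatives of the velocity for [x]-derivatives. *)
Lemma recip_derive_y (x y : R) : y < eta x ->
  is_derive (fun s => recip_re x s) y (- recip_im_x x y) /\
  is_derive (fun s => recip_im x s) y (recip_re_x x y).
Proof.
  intros H.
  assert (I1 := sw_incompressible _ _ _ _ _ _ _ _ hwave x y H).
  assert (I2 := sw_irrotational _ _ _ _ _ _ _ _ hwave x y H).
  destruct (inverse_velocity_derive c (fun s => u x s) (fun s => v x s) y
    (partial_y u x y) (partial_y v x y)) as [E1 E2].
  - apply Derive_correct, (C1_ex_y _ _ (sw_u_C1 _ _ _ _ _ _ _ _ hwave)), H.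
  - apply Derive_correct, (C1_ex_y _ _ (sw_v_C1 _ _ _ _ _ _ _ _ hwave)), H.
  - apply speed_sq_pos; lra.
  - replace (partial_y u x y) with (partial_x v x y) in E1, E2 by lra.
    replace (partial_y v x y) with (- partial_x u x y) in E1, E2 by lra.
    split; eapply is_derive_value; [exact E1 | | exact E2 |];
      unfold recip_re_x, recip_im_x, recip_re, recip_im, speed_sq; ring.
Qed.

Lemma speed_sq_continuous (x y : R) : y < eta x ->
  continuous (fun z : R * R => speed_sq (fst z) (snd z)) (x, y).
Proof.
  intros H. unfold speed_sq.
  assert (C1 := u_fluid_continuous x y H). assert (C2 := v_fluid_continuous x y H).
  apply continuous_Rplus; apply continuous_Rpow2; [|exact C2].
  apply continuous_Rminus; [apply continuous_const | exact C1].
Qed.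

Lemma recip_re_continuous (x y : R) : y < eta x ->
  continuous (fun z : R * R => recip_re (fst z) (snd z)) (x, y).
Proof.
  intros H. apply continuous_Rdiv.
  - apply continuous_Rminus; [apply continuous_const | now apply u_fluid_continuous].
  - now apply speed_sq_continuous.
  - apply Rgt_not_eq, speed_sq_pos. simpl; lra.
Qed.

Lemma recip_im_continuous (x y : R) : y < eta x ->
  continuous (fun z : R * R => recip_im (fst z) (snd z)) (x, y).
Proof.
  intros H. apply continuous_Rdiv.
  - now apply continuous_Ropp, v_fluid_continuous.
  - now apply speed_sq_continuous.
  - apply Rgt_not_eq, speed_sq_pos. simpl; lra.
Qed.

Lemma recip_derivative_continuous (x y : R) : y < eta x ->
  continuous (fun z : R * R => recip_re_x (fst z) (snd z)) (x, y) /\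
  continuous (fun z : R * R => recip_im_x (fst z) (snd z)) (x, y).
Proof.
  intros H.
  assert (Cu := fluid_continuous (partial_x u) x y
    (C1_cont_x _ _ (sw_u_C1 _ _ _ _ _ _ _ _ hwave)) H).
  assert (Cv := fluid_continuous (partial_x v) x y
    (C1_cont_x _ _ (sw_v_C1 _ _ _ _ _ _ _ _ hwave)) H).
  assert (Ca := recip_re_continuous x y H). assert (Cb := recip_im_continuous x y H).
  assert (C1 : continuous (fun z : R * R =>
     recip_re (fst z) (snd z) ^ 2 - recip_im (fst z) (snd z) ^ 2) (x, y)).
  { apply continuous_Rminus; apply continuous_Rpow2; assumption. }
  assert (C2 : continuous (fun z : R * R =>
     2 * recip_re (fst z) (snd z) * recip_im (fst z) (snd z)) (x, y)).
  { apply continuous_Rmult; [|exact Cb].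
    apply continuous_Rmult; [apply continuous_const | exact Ca]. }
  split; [apply continuous_Rplus | apply continuous_Rminus];
    apply continuous_Rmult; assumption.
Qed.

Lemma hodograph_continuous (f : R -> R -> R) (q p : R) : 0 < p ->
  (forall x y, y < eta x -> continuous (fun z : R * R => f (fst z) (snd z)) (x, y)) ->
  continuous (fun z : R * R => f (hodo_x (fst z) (snd z)) (hodo_y (fst z) (snd z))) (q, p).
Proof.
  intros Hp Hf.
  apply (continuous_pair_curve f (fun z : R * R => hodo_x (fst z) (snd z))
           (fun z : R * R => hodo_y (fst z) (snd z))).
  - now apply Hf, hodo_y_interior.
  - now apply hodo_x_continuous.
  - now apply hodo_y_continuous.
Qed.

Lemma fluid_chain_rule (f fx fy : R -> R -> R) (x y : R -> R) (s dx dy : R) :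
  (forall a b, b < eta a -> is_derive (fun t => f t b) a (fx a b)) ->
  (forall a b, b < eta a -> is_derive (fun t => f a t) b (fy a b)) ->
  (forall a b, b < eta a -> continuous (fun z : R * R => fx (fst z) (snd z)) (a, b)) ->
  y s < eta (x s) -> is_derive x s dx -> is_derive y s dy ->
  is_derive (fun t => f (x t) (y t)) s (fx (x s) (y s) * dx + fy (x s) (y s) * dy).
Proof.
  intros Dx Dy Cx Hin Hx Hy. apply is_derive_Reals.
  apply (derivable_pt_lim_comp_2d f x y); [|now apply is_derive_Reals ..].
  apply differentiable_of_partials; [|now apply Dy | now apply Cx].
  apply locally_2d_locally. generalize (fluid_domain_open _ _ Hin).
  apply filter_imp. intros [a b] Hab. now apply Dx.
Qed.

(** [fluct_re + i fluct_im] is [dz / dw - 1 / c] in hodograph coordinates, that is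
[1 / (U + i v)] minus its mean. *)
Definition fluct_re (q p : R) : R := recip_re (hodo_x q p) (hodo_y q p) - 1 / c.
Definition fluct_im (q p : R) : R := recip_im (hodo_x q p) (hodo_y q p).

(** [fluct_re_q + i fluct_im_q] is the complex derivative of [fluct_re + i fluct_im]
with respect to [w]: the derivative in [x + i y] times [dz / dw]. *)
Definition fluct_re_q (q p : R) : R :=
  let x := hodo_x q p in let y := hodo_y q p in
  recip_re_x x y * recip_re x y - recip_im_x x y * recip_im x y.
Definition fluct_im_q (q p : R) : R :=
  let x := hodo_x q p in let y := hodo_y q p in
  recip_im_x x y * recip_re x y + recip_re_x x y * recip_im x y.

Lemma fluct_re_chain (x y : R -> R) (s dx dy : R) :
  y s < eta (x s) -> is_derive x s dx -> is_derive y s dy ->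
  is_derive (fun t => recip_re (x t) (y t) - 1 / c) s
    (recip_re_x (x s) (y s) * dx - recip_im_x (x s) (y s) * dy).
Proof.
  intros Hin Hx Hy. eapply is_derive_value.
  - apply is_derive_Rminus.
    + apply (fluid_chain_rule recip_re recip_re_x (fun a b => - recip_im_x a b));
        [| | |exact Hin|exact Hx|exact Hy].
      * intros a b Hab. exact (proj1 (recip_derive_x a b Hab)).
      * intros a b Hab. exact (proj1 (recip_derive_y a b Hab)).
      * intros a b Hab. exact (proj1 (recip_derivative_continuous a b Hab)).
    + exact (is_derive_Rconst (1 / c) s).
  - ring.
Qed.

Lemma fluct_im_chain (x y : R -> R) (s dx dy : R) :
  y s < eta (x s) -> is_derive x s dx -> is_derive y s dy ->
  is_derive (fun t => recip_im (x t) (y t)) s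
    (recip_im_x (x s) (y s) * dx + recip_re_x (x s) (y s) * dy).
Proof.
  intros Hin Hx Hy.
  apply (fluid_chain_rule recip_im recip_im_x recip_re_x);
    [| | |exact Hin|exact Hx|exact Hy].
  - intros a b Hab. exact (proj2 (recip_derive_x a b Hab)).
  - intros a b Hab. exact (proj2 (recip_derive_y a b Hab)).
  - intros a b Hab. exact (proj2 (recip_derivative_continuous a b Hab)).
Qed.

Lemma fluct_re_derive_q (q p : R) : 0 < p ->
  is_derive (fun s => fluct_re s p) q (fluct_re_q q p).
Proof.
  intros Hp. destruct (hodograph_derive_q q p Hp) as [E1 E2].
  apply (fluct_re_chain (fun s => hodo_x s p) (fun s => hodo_y s p)); auto.
  now apply hodo_y_interior.
Qed.

Lemma fluct_im_derive_q (q p : R) : 0 < p ->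
  is_derive (fun s => fluct_im s p) q (fluct_im_q q p).
Proof.
  intros Hp. destruct (hodograph_derive_q q p Hp) as [E1 E2].
  apply (fluct_im_chain (fun s => hodo_x s p) (fun s => hodo_y s p)); auto.
  now apply hodo_y_interior.
Qed.

Lemma fluct_re_derive_p (q p : R) : 0 < p ->
  is_derive (fun s => fluct_re q s) p (fluct_im_q q p).
Proof.
  intros Hp. destruct (hodograph_derive_p q p Hp) as [E1 E2]. eapply is_derive_value.
  - apply (fluct_re_chain (fun s => hodo_x q s) (fun s => hodo_y q s));
      [now apply hodo_y_interior | exact E1 | exact E2].
  - unfold fluct_im_q. ring.
Qed.

Lemma fluct_im_derive_p (q p : R) : 0 < p ->
  is_derive (fun s => fluct_im q s) p (- fluct_re_q q p).
Proof.
  intros Hp. destruct (hodograph_derive_p q p Hp) as [E1 E2]. eapply is_derive_value.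
  - apply (fluct_im_chain (fun s => hodo_x q s) (fun s => hodo_y q s));
      [now apply hodo_y_interior | exact E1 | exact E2].
  - unfold fluct_re_q. ring.
Qed.

Lemma fluct_re_continuous (q p : R) : 0 < p ->
  continuous (fun z : R * R => fluct_re (fst z) (snd z)) (q, p).
Proof.
  intros Hp. apply continuous_Rminus; [|apply continuous_const].
  apply (hodograph_continuous recip_re); [exact Hp | exact recip_re_continuous].
Qed.

Lemma fluct_im_continuous (q p : R) : 0 < p ->
  continuous (fun z : R * R => fluct_im (fst z) (snd z)) (q, p).
Proof.
  intros Hp. apply (hodograph_continuous recip_im);
    [exact Hp | exact recip_im_continuous].
Qed.

Lemma fluct_re_q_continuous (q p : R) : 0 < p ->
  continuous (fun z : R * R => fluct_re_q (fst z) (snd z)) (q, p).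
Proof.
  intros Hp. apply (hodograph_continuous (fun x y =>
    recip_re_x x y * recip_re x y - recip_im_x x y * recip_im x y));
    [exact Hp|].
  intros x y H. destruct (recip_derivative_continuous x y H) as [C1 C2].
  apply continuous_Rminus; apply continuous_Rmult;
    auto using recip_re_continuous, recip_im_continuous.
Qed.

Lemma fluct_im_q_continuous (q p : R) : 0 < p ->
  continuous (fun z : R * R => fluct_im_q (fst z) (snd z)) (q, p).
Proof.
  intros Hp. apply (hodograph_continuous (fun x y =>
    recip_im_x x y * recip_re x y + recip_re_x x y * recip_im x y));
    [exact Hp|].
  intros x y H. destruct (recip_derivative_continuous x y H) as [C1 C2].
  apply continuous_Rplus; apply continuous_Rmult;
    auto using recip_re_continuous, recip_im_continuous.
Qed.

Lemma hodograph_periodic (q p : R) : 0 < p ->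
  fluct_re (q + c * lambda) p = fluct_re q p /\ fluct_im (q + c * lambda) p = fluct_im q p.
Proof.
  intros Hp. unfold fluct_re, fluct_im, recip_re, recip_im, speed_sq, hodo_y.
  rewrite hodo_x_over_period, xi_periodic by exact Hp.
  destruct (sw_periodic _ _ _ _ _ _ _ _ hwave (hodo_x q p) (xi (hodo_x q p) p))
    as [-> [-> _]]; [|now split].
  apply (xi_closed (hodo_x q p) p). lra.
Qed.

(** * Monotonicity of the period and positivity of the drift *)

Definition excess (p : R) : R := cross_energy (c * lambda) fluct_re fluct_im p p.

(** Expanding the square gives an explicit primitive: the square modulus
of [1 / (U + i v)] is the [q]-derivative of the travel time
[elapsed p (hodo_x q p)], and its real part that of [hodo_x].  Over a period
these gain [period p] and [lambda]. *)
Lemma excess_period (p : R) : 0 < p -> excess p = period p - lambda / c.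
Proof.
  intros Hp.
  (* The terms are those of [|f|^2 - (2 / c) Re f + 1 / c^2] for [f = 1 / (U + i v)]. *)
  pose (F := fun q => (elapsed p (hodo_x q p) - 2 / c * hodo_x q p) + 1 / c * (1 / c) * q).
  assert (HF : is_RInt
     (fun q => fluct_re q p * fluct_re q p + fluct_im q p * fluct_im q p) 0 (c * lambda)
     (minus (F (c * lambda)) (F 0))).
  { apply (is_RInt_derive F).
    - intros q _. destruct (hodograph_derive_q q p Hp) as [Ex _].
      unfold F. eapply is_derive_value.
      + apply is_derive_Rplus; [apply is_derive_Rminus|].
        * apply (is_derive_comp (elapsed p) (fun q => hodo_x q p));
            [apply elapsed_derive | exact Ex].
        * apply is_derive_Rmult; [apply is_derive_Rconst | exact Ex].
        * apply is_derive_Rmult; [apply is_derive_Rconst | apply is_derive_Rid].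
      + assert (Hc := hodo_y_interior q p Hp).
        assert (S := speed_sq_pos (hodo_x q p) (hodo_y q p) ltac:(lra)).
        assert (U := u_lt_c (hodo_x q p) (hodo_y q p) ltac:(lra)).
        rewrite slowness_fluid by lra. fold (hodo_y q p).
        unfold scal; simpl; unfold mult; simpl.
        unfold fluct_re, fluct_im, recip_re, recip_im. unfold speed_sq in *. field.
        repeat split; lra.
    - intros q _. apply cross_integrand_continuous;
        auto using fluct_re_continuous, fluct_im_continuous. }
  unfold excess, cross_energy. rewrite (is_RInt_unique _ _ _ _ HF).
  unfold F, minus, plus, opp; simpl.
  assert (E := hodo_x_over_period 0 p Hp). rewrite Rplus_0_l in E.
  rewrite E, elapsed_over_period. field. lra.
Qed.

Lemma wave_energy_length_pos : 0 < c * lambda.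
Proof. now apply Rmult_lt_0_compat. Qed.

Lemma excess_nonneg (p : R) : 0 < p -> 0 <= excess p.
Proof.
  apply (energy_nonneg (c * lambda) fluct_re fluct_im wave_energy_length_pos
           fluct_re_continuous fluct_im_continuous).
Qed.

Lemma excess_log_convex (p1 p2 : R) : 0 < p1 -> 0 < p2 ->
  excess ((p1 + p2) / 2) * excess ((p1 + p2) / 2) <= excess p1 * excess p2.
Proof.
  apply (energy_midpoint_log_convex (c * lambda) fluct_re fluct_im fluct_re_q fluct_im_q
    wave_energy_length_pos fluct_re_derive_q fluct_im_derive_q fluct_re_derive_p fluct_im_derive_p
    fluct_re_continuous fluct_im_continuous fluct_re_q_continuous fluct_im_q_continuous).
  - intros p Hp. rewrite <- (Rplus_0_l (c * lambda)). now apply hodograph_periodic.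
  - intros p Hp. rewrite <- (Rplus_0_l (c * lambda)). now apply hodograph_periodic.
Qed.

(** Since the velocity is bounded, [psi] is bounded on each horizontal line in the
fluid, so streamlines with large [p] lie below it. *)
Lemma deep_streamline (Y : R) : exists P0, 0 < P0 /\ forall x p, P0 <= p -> xi x p < Y.
Proof.
  destruct (sw_bounded _ _ _ _ _ _ _ _ hwave) as [M HM].
  pose (Y' := Rmin Y base_level - 1).
  assert (HY' : Y' < Y /\ Y' < base_level).
  { unfold Y'. generalize (Rmin_l Y base_level) (Rmin_r Y base_level). lra. }
  pose (P0 := (c + Rabs M) * (eta 0 - Y') + 1).
  assert (HP0 : 0 < P0).
  { unfold P0. generalize (Rabs_pos M) (base_level_fluid 0). intros.
    assert (0 <= (c + Rabs M) * (eta 0 - Y')) by (apply Rmult_le_pos; lra). lra. }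
  exists P0. split; [exact HP0|]. intros x p Hp.
  apply Rlt_trans with Y'; [|apply HY'].
  destruct (Rlt_or_le (xi x p) Y') as [|L]; [assumption|exfalso].
  assert (Hx := base_level_fluid x).
  assert (B : psi_ext x Y' <= (c + Rabs M) * (eta 0 - Y')).
  (* The bound [M] is only known in the open fluid, and the mean value point could be the
     surface point; [Rmax] keeps the lower bound for the slope there. *)
  { destruct (MVT_gen (psi_ext x) Y' (eta x) (fun y => Rmax (u x y - c) (- (c + Rabs M))))
      as [y [_ E]].
    - rewrite Rmin_left, Rmax_right by lra. intros y Hy.
      destruct (HM x y) as [Hu _]; [unfold fluid_domain; simpl; lra|].
      rewrite Rmax_left.
      + apply psi_ext_derive_y. lra.
      + generalize (Rle_abs M) (Rle_abs (- u x y)). rewrite Rabs_Ropp. lra.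
    - intros y _. apply psi_ext_continuity_pt.
    - rewrite (psi_ext_above x (eta x)) in E by lra.
      assert (- (c + Rabs M) <= Rmax (u x y - c) (- (c + Rabs M))) by apply Rmax_r.
      assert (Hb := eta_bounds x). assert (0 <= Rabs M) by apply Rabs_pos.
      assert ((c + Rabs M) * (eta x - Y') <= (c + Rabs M) * (eta 0 - Y'))
        by (apply Rmult_le_compat_l; lra).
      nra. }
  assert (psi_ext x (xi x p) <= psi_ext x Y').
  { destruct L as [L| <-]; [apply Rlt_le, psi_ext_decreasing, L | lra]. }
  rewrite psi_ext_xi in *. unfold P0 in Hp. lra.
Qed.

Lemma period_bounded : exists B P0, 0 < P0 /\ forall p, P0 <= p -> period p <= B.
Proof.
  destruct (sw_deep _ _ _ _ _ _ _ _ hwave (c / 2)) as [Y HY]; [lra|].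
  destruct (deep_streamline Y) as [P0 [HP0 HP]].
  exists ((lambda / 2 - - lambda / 2) * (2 / c)), P0. split; [exact HP0|].
  intros p Hp.
  apply Rle_trans with (RInt (fun _ => 2 / c) (- lambda / 2) (lambda / 2)).
  - apply RInt_le; [lra | apply slowness_integrable | apply ex_RInt_const |].
    intros x _. rewrite slowness_fluid by lra.
    assert (Hin := xi_interior x p ltac:(lra)).
    destruct (HY x (xi x p)) as [Hu _]; [exact Hin | now apply HP |].
    apply Rabs_def2 in Hu.
    replace (2 / c) with (1 / (c / 2)) by (field; lra).
    apply Rmult_le_compat_l; [lra|]. apply Rinv_le_contravar; lra.
  - rewrite RInt_const. apply Rle_refl.
Qed.

Lemma period_nonincreasing (p1 p2 : R) : 0 < p1 -> p1 <= p2 -> period p2 <= period p1.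
Proof.
  intros H1 H12. destruct period_bounded as [B [P0 [HP0 HB]]].
  assert (E := log_convex_bounded_nonincreasing excess excess_nonneg excess_log_convex
    (B - lambda / c) P0).
  assert (M : excess p2 <= excess p1).
  { apply E; [|exact H1|exact H12].
    intros p Hp. rewrite excess_period by lra. specialize (HB p Hp). lra. }
  rewrite !excess_period in M by lra. lra.
Qed.

(** If the excess vanishes for one [p], it vanishes for all; then [v = 0] along every
streamline below the surface, which is therefore horizontal, and in the limit
[p = 0] the crest and the trough would have the same height. *)
Lemma excess_nonzero (p : R) : 0 < p -> excess p <> 0.
Proof.
  intros Hp Z.
  assert (Flat : forall r, 0 < r -> xi 0 r = xi (lambda / 2) r).
  { intros r Hr.
    assert (Zr := log_convex_zero_everywhere excess excess_log_convex p Hp Z r Hr).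
    assert (Be : forall q, 0 < q < c * lambda -> fluct_im q r = 0).
    { intros q Hq.
      assert (N : fluct_re q r * fluct_re q r + fluct_im q r * fluct_im q r = 0); [|nra].
      apply (RInt_zero_of_nonneg
        (fun q => fluct_re q r * fluct_re q r + fluct_im q r * fluct_im q r)
               0 (c * lambda)); [| |exact Zr|exact Hq].
      - intros s. apply cross_integrand_continuous;
          auto using fluct_re_continuous, fluct_im_continuous.
      - intros s. apply Rplus_le_le_0_compat; apply Rle_0_sqr. }
    pose (a := hodo_x 0 r).
    assert (Da : forall x, a < x < a + lambda -> is_derive (fun s => xi s r) x 0).
    { intros x Hx. assert (Hc := xi_closed x r ltac:(lra)).
      eapply is_derive_value; [apply xi_derive; lra|].
      assert (Hq : 0 < Phi r x < c * lambda).
      { assert (E0 : Phi r a = 0) by now apply Phi_hodo_x.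
        assert (E1 := Phi_over_period r a Hr).
        assert (Phi r a < Phi r x) by (apply Phi_increasing; lra).
        assert (Phi r x < Phi r (a + lambda)) by (apply Phi_increasing; lra). lra. }
      apply Be in Hq. unfold fluct_im, hodo_y in Hq. rewrite hodo_x_Phi in Hq by exact Hr.
      assert (S := speed_sq_pos x (xi x r) Hc). assert (U := u_lt_c x (xi x r) Hc).
      assert (V : v x (xi x r) = 0).
      { replace (v x (xi x r)) with (- recip_im x (xi x r) * speed_sq x (xi x r))
          by (unfold recip_im; field; lra).
        rewrite Hq. ring. }
      rewrite V. field. lra. }
    assert (Const : forall x, xi x r = xi a r).
    { intros x.
      destruct (periodic_representative (fun s => xi (s + (a + lambda / 2)) r) lambda hlambda)
        with (x - (a + lambda / 2)) as [x' [Hx' E]].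
      { intros s. replace (s + lambda + (a + lambda / 2))
          with (s + (a + lambda / 2) + lambda) by ring. apply xi_periodic. }
      cbv beta in E.
      replace (x - (a + lambda / 2) + (a + lambda / 2)) with x in E by ring.
      rewrite <- E. apply (zero_derivative_constant (fun s => xi s r)).
      - lra.
      - intros s Hs. apply Da. lra.
      - intros s _. apply continuity_pt_filterlim, (row_continuous xi), xi_continuous. }
    now rewrite (Const 0), (Const (lambda / 2)). }
  assert (C : continuous (fun r => xi 0 r - xi (lambda / 2) r) 0).
  { apply continuous_Rminus; apply (column_continuous xi), xi_continuous. }
  assert (L : locally 0 (fun r => 0 < xi 0 r - xi (lambda / 2) r)).
  { apply (C (fun t => 0 < t)), (open_gt 0).
    rewrite !xi_surface. generalize crest_above_trough. lra. }
  destruct L as [d Hd].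
  assert (Hd2 : 0 < d / 2) by (generalize (cond_pos d); lra).
  specialize (Hd (d / 2)). rewrite (Flat _ Hd2) in Hd.
  assert (0 < xi (lambda / 2) (d / 2) - xi (lambda / 2) (d / 2)); [|lra].
  apply Hd. change (Rabs (d / 2 - 0) < d). rewrite Rminus_0_r, Rabs_pos_eq by lra.
  lra.
Qed.

Lemma period_le_surface (p : R) : 0 <= p -> period p <= period 0.
Proof.
  intros [Hp| <-]; [|lra].
  destruct (Rle_or_lt (period p) (period 0)) as [|H]; [assumption|exfalso].
  assert (L : locally 0 (fun r => period r < period p))
    by apply (period_continuous 0 (fun t => t < period p)), (open_lt (period p)), H.
  destruct L as [d Hd].
  pose (r := Rmin (d / 2) p).
  assert (Hr : 0 < r <= p /\ r < d).
  { unfold r. generalize (cond_pos d) (Rmin_l (d / 2) p) (Rmin_r (d / 2) p).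
    assert (0 < Rmin (d / 2) p) by (apply Rmin_glb_lt; generalize (cond_pos d); lra).
    lra. }
  assert (Hball : ball 0 d r).
  { change (Rabs (r - 0) < d). rewrite Rminus_0_r, Rabs_pos_eq; lra. }
  apply Hd in Hball. assert (M := period_nonincreasing r p). lra.
Qed.

Lemma period_gt_wave_period (p : R) : 0 <= p -> lambda / c < period p.
Proof.
  assert (A : forall p, 0 < p -> lambda / c < period p).
  { intros r Hr. assert (E := excess_period r Hr).
    assert (N := excess_nonneg r Hr). assert (N' := excess_nonzero r Hr). lra. }
  intros [Hp| <-]; [now apply A|].
  apply Rlt_le_trans with (period 1); [apply A | apply period_le_surface]; lra.
Qed.

Lemma period_surface :
  period 0 = RInt (fun x => 1 / (c - u x (eta x))) (- lambda / 2) (lambda / 2).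
Proof.
  apply RInt_ext. intros x _. rewrite slowness_fluid by lra. now rewrite xi_surface.
Qed.

Lemma drift_pos (p : R) : 0 <= p -> 0 < c * period p - lambda.
Proof.
  intros Hp. assert (H := period_gt_wave_period p Hp).
  apply Rmult_lt_compat_l with (r := c) in H; [|exact hc].
  replace (c * (lambda / c)) with lambda in H by (field; lra). lra.
Qed.

(** A closed path is bounded, as a continuous periodic motion, while a motion with
constant positive drift takes every value. *)
Lemma path_not_closed (X Y : R -> R) :
  particle_path c eta u v X Y -> ~ closed_path X Y.
Proof.
  intros HXY [tau [Htau Hper]].
  pose (p := psi (X 0 - c * 0) (Y 0)).
  assert (Hon : lies_on c eta psi p X Y).
  { exists 0. split; [apply (pp_fluid _ _ _ _ _ _ HXY) | reflexivity]. }
  assert (Hp := lies_on_nonneg X Y p Hon).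
  assert (D := drift_pos p Hp). assert (T := period_pos p).
  set (d := c * period p - lambda) in *.
  assert (XT : forall t, X (t + period p) = X t + d).
  { intros t. assert (E := path_period X Y HXY p t Hon).
    rewrite Rplus_comm in E. unfold d. lra. }
  destruct (continuity_ab_maj X 0 tau) as [tmax [Hmax _]]; [lra| |].
  { intros t _. apply (is_derive_continuity_pt _ _ _ (pp_x _ _ _ _ _ _ HXY t)). }
  assert (Bound : forall t, X t <= X tmax).
  { intros t.
    destruct (periodic_representative (fun s => X (s + tau / 2)) tau Htau) with (t - tau / 2)
      as [t' [Ht' E]].
    { intros s. replace (s + tau + tau / 2) with (s + tau / 2 + tau) by ring. apply Hper. }
    cbv beta in E. replace (t - tau / 2 + tau / 2) with t in E by ring.
    rewrite <- E. apply Hmax. lra. }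
  destruct (quasi_periodic_surjective X (period p) d) with (X tmax + 1) as [t Ht].
  - intros t. apply (is_derive_continuity_pt _ _ _ (pp_x _ _ _ _ _ _ HXY t)).
  - exact D.
  - exact XT.
  - generalize (Bound t). lra.
Qed.

End Wave.

Theorem theorem3p2 (c lambda g Patm : R) (eta : R -> R)
    (u v P psi : R -> R -> R)
    (hc : 0 < c) (hlambda : 0 < lambda) (hg : 0 < g)
    (hwave : stokes_wave c lambda g Patm eta u v P)
    (hpsi : is_stream_function c eta u v psi) :
  (forall p : R, 0 <= p ->
     lambda / c < time_period c lambda eta u v psi p /\
     time_period c lambda eta u v psi p
       <= RInt (fun x => 1 / (c - u x (eta x))) (- lambda / 2) (lambda / 2)) /\
  (forall X Y : R -> R, particle_path c eta u v X Y -> ~ closed_path X Y) /\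
  (forall (p : R) (X Y : R -> R) (t0 : R), 0 <= p ->
     particle_path c eta u v X Y -> lies_on c eta psi p X Y ->
     X (time_period c lambda eta u v psi p + t0) - X t0
       = c * time_period c lambda eta u v psi p - lambda /\
     0 < c * time_period c lambda eta u v psi p - lambda).
Proof.
  assert (Eq := time_period_eq c lambda g Patm eta u v P psi hc hlambda hwave hpsi).
  split; [|split].
  - intros p Hp. rewrite (Eq p Hp).
    rewrite <- (period_surface c lambda g Patm eta u v P psi hc hwave hpsi).
    split.
    + eapply period_gt_wave_period; eassumption.
    + eapply period_le_surface; eassumption.
  - intros X Y HXY.
    exact (path_not_closed c lambda g Patm eta u v P psi hc hlambda hwave hpsi X Y HXY).
  - intros p X Y t0 Hp HXY Hon. rewrite (Eq p Hp). split.
    + assert (E := path_period c lambda g Patm eta u v P psi hc hwave hpsi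
        X Y HXY p t0 Hon).
      lra.
    + eapply drift_pos; eassumption.
Qed.
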